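(* Let $n\ge3$. Let $G$ be the group generated by $\{\sigma,Z,U,V\}$ subject to the following relations. Then $G$ is isomorphic to $\Omega^+(2n,2)$. (i) Defining relations for $S_n$ on $\{U,V\}$, with $U=(1,2)$, $V=(1,2,\dots,n)$; $[Z,U^{V^2}]=1$ if $n>3$; $[Z,VUU^V]=1$ if $n>4$; $Z^2=1$; $[Z,Z^{V^2}]=1$ if $n>3$; $ZZ^V=Z^{U^V}$; $[Z,U]=1$; $[Z,Z^V]=1$. (ii) Relations stating that $\sigma$ is centralised by: $U^{V^2}$ if $n>3$; $VUU^V$ if $n>4$; $Z^{V^2}$ if $n>3$; $ZU$. (iii) Relations that present $\mathrm{SL}(2,2)$ on $\{\sigma,U\}$. (iv) (a) $[\sigma,\sigma^V]=\sigma^{VU}$; (b) $[\sigma,\sigma^{VU}]=1$; (c) $[\sigma,\sigma^W]=1$, where $W=U^{VU}$; (d) if $n>3$ then $[\sigma,\sigma^{V^2}]=1$; (e) $[\sigma,\sigma^{Z^V}]=1$; (f) if $n=4$ then $[\sigma,\sigma^{Z^VV^2}]=1$.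
   Context: Conventions: $x^y=y^{-1}xy$, $[x,y]=x^{-1}y^{-1}xy$. Linear maps act on the right and fix unmentioned basis vectors. Generators of the presented group are denoted by the same symbols as the corresponding matrices. ''Relations that present (defining relations for) a group on given elements $g_1,\dots,g_k$'' means any set of relators in the free group on $k$ letters whose normal closure is the kernel of the natural map onto $\langle g_1,\dots,g_k\rangle$. Matrices over $\mathrm{GF}(2)$: $e_1,f_1,\dots,e_n,f_n$ is a hyperbolic basis of the natural module of $\Omega^+(2n,2)$: the quadratic form vanishes on all $e_i,f_i$ and its polar form has $e_i.f_i=1$ and other products zero; $\Omega^+(2n,2)$ is the index $2$ subgroup (kernel of the Dickson invariant) of the full isometry group. $\sigma=(e_1\mapsto e_1+e_2,\ f_2\mapsto f_2+f_1)$; $Z$ interchanges $e_1,f_1$ and $e_2,f_2$; $U$ interchanges $e_1,e_2$ and $f_1,f_2$; $V=(e_1,\dots,e_n)(f_1,\dots,f_n)$ cyclically permutes the $e_i$ and the $f_i$. In (iii), the matrices $\sigma,U$ act on $(e_1,e_2)$ as $\begin{pmatrix}1&1\\0&1\end{pmatrix}$, $\begin{pmatrix}0&1\\1&0\end{pmatrix}$. *)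

(* Defs.v *)
From HB Require Import structures.
From mathcomp Require Import all_boot all_order all_algebra all_fingroup.
From mathcomp Require Import boolp classical_sets.

Set Implicit Arguments.
Unset Strict Implicit.
Unset Printing Implicit Defensive.

Local Open Scope quotient_scope.
Local Open Scope classical_set_scope.
Local Open Scope group_scope.

(* A letter [(i, b)] is the [i]-th generator if [b = false] and its inverse if
   [b = true]; the free group is the set of freely reduced words. *)
Section ReducedWords.
Variable k : nat.
Local Notation letter := ('I_k * bool)%type.
Implicit Types (x : letter) (s t u w : seq letter).

Definition linv x : letter := (x.1, ~~ x.2).

Lemma linvK : involutive linv.
Proof. by case=> i b; rewrite /linv /= negbK. Qed.

Arguments linv : simpl never.

Definition reduced w := sorted (fun x y => y != linv x) w.

Definition rcons_l x w :=
  if w is y :: w' then if y == linv x then w' else x :: w else [:: x].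

Definition wmul s t := foldr rcons_l t s.

Definition winv s := rev (map linv s).

Lemma reduced_behead x w : reduced (x :: w) -> reduced w.
Proof. by case: w => //= y w /andP[]. Qed.

Lemma reduced_rcons_l x w : reduced w -> reduced (rcons_l x w).
Proof.
case: w => //= y w rw; case: eqP => [_|/eqP ne]; first exact: reduced_behead rw.
by rewrite /reduced /= ne.
Qed.

Lemma reduced_wmul s t : reduced t -> reduced (wmul s t).
Proof. by move=> rt; elim: s => //= x s; apply: reduced_rcons_l. Qed.

Lemma rcons_lK x w : reduced w -> rcons_l (linv x) (rcons_l x w) = w.
Proof.
case: w => [|y w] rw /=; first by rewrite linvK eqxx.
case: eqP => [Ey | _] /=; last by rewrite linvK eqxx.
by rewrite {y}Ey in rw *; case: w rw => //= z w /andP[/negPf ->].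
Qed.

Lemma rcons_lVK x w : reduced w -> rcons_l x (rcons_l (linv x) w) = w.
Proof. by move=> rw; rewrite -{1}[x]linvK rcons_lK. Qed.

Lemma wmul_rcons_l x s t :
  reduced t -> wmul (rcons_l x s) t = rcons_l x (wmul s t).
Proof.
case: s => [|y s] //= rt; case: eqP => //= ->.
by rewrite rcons_lVK // reduced_wmul.
Qed.

Lemma wmulA s t u : reduced u -> wmul s (wmul t u) = wmul (wmul s t) u.
Proof. by move=> ru; elim: s => //= x s ->; rewrite wmul_rcons_l. Qed.

Lemma wmuls0 s : reduced s -> wmul s [::] = s.
Proof.
elim: s => //= x s IH rs; rewrite IH; last exact: reduced_behead rs.
by case: s rs {IH} => //= y s /andP[/negPf ->].
Qed.

Lemma wmul_cat s t u : wmul (s ++ t) u = wmul s (wmul t u).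
Proof. exact: foldr_cat. Qed.

Lemma wmulVK s t : reduced t -> wmul (winv s) (wmul s t) = t.
Proof.
move=> rt; elim: s => //= x s IH.
by rewrite /winv /= rev_cons -cats1 wmul_cat /= rcons_lK ?reduced_wmul.
Qed.

Lemma winvK s : winv (winv s) = s.
Proof. by rewrite /winv map_rev revK mapK //; exact: linvK. Qed.

Lemma wmulKV s t : reduced t -> wmul s (wmul (winv s) t) = t.
Proof. by move=> rt; rewrite -{1}[s]winvK wmulVK. Qed.

Lemma reduced_winv s : reduced s -> reduced (winv s).
Proof.
rewrite /reduced /winv rev_sorted sorted_map; apply: sub_sorted => x y.
by apply: contra => /eqP ->; rewrite linvK.
Qed.

Definition free_group := {w : seq letter | reduced w}.

End ReducedWords.

HB.instance Definition _ k := Choice.on (free_group k).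

Section FreeGroup.
Variable k : nat.
Implicit Types a b c : free_group k.

Definition fg_one : free_group k := exist _ [::] isT.
Definition fg_mul a b : free_group k :=
  exist _ (wmul (val a) (val b)) (reduced_wmul (val a) (valP b)).
Definition fg_inv a : free_group k :=
  exist _ (winv (val a)) (reduced_winv (valP a)).

Lemma fg_mulA : associative fg_mul.
Proof. by move=> a b c; apply: val_inj; rewrite /= wmulA // (valP c). Qed.

Lemma fg_mul1 : left_id fg_one fg_mul.
Proof. by move=> a; apply: val_inj. Qed.

Lemma fg_mulr1 : right_id fg_one fg_mul.
Proof. by move=> a; apply: val_inj; rewrite /= wmuls0 // (valP a). Qed.

Lemma fg_mulV : left_inverse fg_one fg_inv fg_mul.
Proof.
move=> a; apply: val_inj => /=.
by rewrite -{2}[val a]wmuls0 ?(valP a) // wmulVK.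
Qed.

Lemma fg_mulrV : right_inverse fg_one fg_inv fg_mul.
Proof.
move=> a; apply: val_inj => /=.
by rewrite -[winv _]wmuls0 ?reduced_winv ?(valP a) // wmulKV.
Qed.

HB.instance Definition _ := isGroup.Build (free_group k)
  fg_mulA fg_mul1 fg_mulr1 fg_mulV fg_mulrV.

Definition fg_gen (i : 'I_k) : free_group k := exist _ [:: (i, false)] isT.

End FreeGroup.

(* The homomorphism from the free group that sends the [i]-th generator to the
   [i]-th entry of [g]. *)
Section FreeEval.
Variables (k : nat) (H : groupType) (g : k.-tuple H).

Definition leval (x : 'I_k * bool) : H :=
  if x.2 then (tnth g x.1)^-1 else tnth g x.1.

Definition fg_eval (a : free_group k) : H := \prod_(x <- val a) leval x.

Lemma leval_inv x : leval (linv x) = (leval x)^-1.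
Proof. by case: x => i [] /=; rewrite /leval /= ?invgK. Qed.

Lemma fg_evalM : {morph fg_eval : a b / a * b}.
Proof.
move=> a b; rewrite /fg_eval /=; elim: (val a) => [|x s IH] /=.
  by rewrite big_nil mul1g.
rewrite big_cons -mulgA -IH; case: (wmul s _) => [|y w] /=.
  by rewrite big_seq1 big_nil mulg1.
by case: eqP => [->|_]; rewrite !big_cons // leval_inv mulVKg.
Qed.

Lemma fg_eval1 : fg_eval 1 = 1.
Proof. exact: big_nil. Qed.

HB.instance Definition _ :=
  isUMagmaMorphism.Build (free_group k) H fg_eval (conj fg_eval1 fg_evalM).

Lemma fg_eval_gen i : fg_eval (fg_gen i) = tnth g i.
Proof. exact: big_seq1. Qed.

End FreeEval.

Definition normal_subgroup (G : groupType) (N : set G) : Prop :=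
  [/\ N 1, forall x y, N x -> N y -> N (x * y^-1) & forall x y, N x -> N (x ^ y)].

Definition normal_closure (G : groupType) (R : set G) : set G :=
  smallest (@normal_subgroup G) R.

Lemma normal_closureP (G : groupType) (R : set G) :
  normal_subgroup (normal_closure R).
Proof.
split=> [M [[]] //|x y Rx Ry M MR|x y Rx M MR]; have [[M1 MF MJ] _] := MR.
  by apply: MF; [apply: Rx | apply: Ry].
by apply: MJ; apply: Rx.
Qed.

Section QuotientGroup.
Variables (G : groupType) (R : set G).
Local Notation N := (normal_closure R).

Lemma ncl1 : N 1. Proof. by case: (normal_closureP R). Qed.

Lemma nclJ x y : N x -> N (x ^ y).
Proof. by case: (normal_closureP R) => _ _; apply. Qed.

Lemma nclV x : N x -> N x^-1.
Proof. by case: (normal_closureP R) => N1 NF _ Nx; rewrite -div1g; apply: NF. Qed.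

Lemma nclM x y : N x -> N y -> N (x * y).
Proof.
case: (normal_closureP R) => _ NF _ Nx Ny.
by rewrite -[y]invgK; apply: NF => //; apply: nclV.
Qed.

Definition ncl_rel : rel G := fun x y => `[< N (x^-1 * y) >].

Lemma ncl_rel_refl : reflexive ncl_rel.
Proof. by move=> x; apply/asboolP; rewrite mulVg; apply: ncl1. Qed.

Lemma ncl_rel_sym : symmetric ncl_rel.
Proof.
by move=> x y; apply/asboolP/asboolP => /nclV; rewrite invgM invgK.
Qed.

Lemma ncl_rel_trans : transitive ncl_rel.
Proof.
move=> y x z /asboolP xy /asboolP yz; apply/asboolP.
by have := nclM xy yz; rewrite -mulgA mulVKg.
Qed.

Canonical ncl_equiv := EquivRel ncl_rel ncl_rel_refl ncl_rel_sym ncl_rel_trans.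

Definition quotient_group := {eq_quot ncl_equiv}.

HB.instance Definition _ := Choice.on quotient_group.
HB.instance Definition _ := EqQuotient.on quotient_group.

Local Notation repr := generic_quotient.repr.

Definition qg_mk (x : G) : quotient_group := \pi x.
Definition qg_one : quotient_group := qg_mk 1.
Definition qg_mul (a b : quotient_group) := qg_mk (repr a * repr b).
Definition qg_inv (a : quotient_group) := qg_mk (repr a)^-1.

Lemma qg_mkP x y : qg_mk x = qg_mk y <-> N (x^-1 * y).
Proof.
by split=> [/eqP|xy]; [|apply/eqP]; rewrite /qg_mk eqmodE; [move/asboolP|apply/asboolP].
Qed.

Lemma repr_qg_mk x : exists2 z, N z & repr (qg_mk x) = x * z.
Proof.
exists (x^-1 * repr (qg_mk x)); last by rewrite mulVKg.
by apply/qg_mkP; rewrite /qg_mk reprK.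
Qed.

Lemma qg_mkM x y : qg_mk (x * y) = qg_mul (qg_mk x) (qg_mk y).
Proof.
have [[z Nz Ez] [t Nt Et]] := (repr_qg_mk x, repr_qg_mk y).
apply/qg_mkP; rewrite Ez Et.
have -> : (x * y)^-1 * (x * z * (y * t)) = z ^ y * t.
  by rewrite conjgE invgM !mulgA mulgVK.
by apply: nclM => //; apply: nclJ.
Qed.

Lemma qg_mkV x : qg_mk x^-1 = qg_inv (qg_mk x).
Proof.
have [z Nz Ez] := repr_qg_mk x.
apply/qg_mkP; rewrite Ez invgK invgM.
by have := nclJ x^-1 (nclV Nz); rewrite conjgE invgK.
Qed.

Lemma qg_mkK (a : quotient_group) : qg_mk (repr a) = a.
Proof. exact: reprK. Qed.

Lemma qg_mulA : associative qg_mul.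
Proof.
by move=> a b c; rewrite -[a]qg_mkK -[b]qg_mkK -[c]qg_mkK -!qg_mkM mulgA.
Qed.

Lemma qg_mul1 : left_id qg_one qg_mul.
Proof. by move=> a; rewrite -[a]qg_mkK -qg_mkM mul1g. Qed.

Lemma qg_mulr1 : right_id qg_one qg_mul.
Proof. by move=> a; rewrite -[a]qg_mkK -qg_mkM mulg1. Qed.

Lemma qg_mulV : left_inverse qg_one qg_inv qg_mul.
Proof. by move=> a; rewrite -[a]qg_mkK -qg_mkV -qg_mkM mulVg. Qed.

Lemma qg_mulrV : right_inverse qg_one qg_inv qg_mul.
Proof. by move=> a; rewrite -[a]qg_mkK -qg_mkV -qg_mkM mulgV. Qed.

HB.instance Definition _ := isGroup.Build quotient_group
  qg_mulA qg_mul1 qg_mulr1 qg_mulV qg_mulrV.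

HB.instance Definition _ :=
  isUMagmaMorphism.Build G quotient_group qg_mk (conj erefl qg_mkM).

End QuotientGroup.

Definition presented_group k (R : set (free_group k)) := quotient_group R.

HB.instance Definition _ k (R : set (free_group k)) :=
  Group.on (presented_group R).

(* [R] is a set of defining relators, on the elements of [g], for the subgroup
   that they generate: its normal closure is the kernel of the natural map. *)
Definition presents (H : groupType) k (g : k.-tuple H)
    (R : set (free_group k)) : Prop :=
  normal_closure R = [set a | fg_eval g a = 1].

(* Points are numbered from 0; permutations compose from left to right. *)
Definition sym_U n (hn : 2 < n) : {perm 'I_n} :=
  tperm (Ordinal (ltnW (ltnW hn))) (Ordinal (ltnW hn)).
Definition sym_V n : {perm 'I_n} := perm (@ordS_inj n).

Section SL2.
Local Open Scope ring_scope.

(* Matrices act on row vectors from the right. *)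
Definition sigma2_mx : 'M['F_2]_2 :=
  \matrix_(i, j) (if (i == 1) && (j == 0) then 0 else 1).
Definition U2_mx : 'M['F_2]_2 :=
  \matrix_(i, j) (if i == j then 0 else 1).

Lemma sigma2_unit : sigma2_mx \is a GRing.unit.
Proof.
apply: (@mulmx1_unit _ _ _ sigma2_mx _).1; apply/matrixP => i j.
rewrite !mxE !big_ord_recl big_ord0 !mxE.
by case: i => [[|[|//]] ?]; case: j => [[|[|//]] ?]; apply/eqP.
Qed.

Lemma U2_unit : U2_mx \is a GRing.unit.
Proof.
apply: (@mulmx1_unit _ _ _ U2_mx _).1; apply/matrixP => i j.
rewrite !mxE !big_ord_recl big_ord0 !mxE.
by case: i => [[|[|//]] ?]; case: j => [[|[|//]] ?]; apply/eqP.
Qed.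

Definition SL2_sigma : {'GL_2['F_2]} := FinRing.unit _ sigma2_unit.
Definition SL2_U : {'GL_2['F_2]} := FinRing.unit _ U2_unit.

End SL2.

Section Orthogonal.
Local Open Scope ring_scope.
Variable n : nat.
Implicit Types A B : 'M['F_2]_(n + n).

(* The coordinates of [e_i] and [f_i] are [lshift n i] and [rshift n i]. *)
Definition hyp_quad (v : 'rV['F_2]_(n + n)) : 'F_2 :=
  \sum_(i < n) v 0 (lshift n i) * v 0 (rshift n i).

(* Vectors are rows, so that [A] acts on the right. *)
Definition isometry A : bool :=
  (A \in unitmx) && [forall v, hyp_quad (v *m A) == hyp_quad v].

Lemma isometry1 : isometry 1%:M.
Proof. by rewrite /isometry unitmx1; apply/forallP => v; rewrite mulmx1. Qed.

Lemma isometryM A B : isometry A -> isometry B -> isometry (A *m B).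
Proof.
move=> /andP[uA /forallP qA] /andP[uB /forallP qB].
rewrite /isometry unitmx_mul uA uB; apply/forallP => v.
by rewrite mulmxA (eqP (qB _)).
Qed.

Lemma isometryV A : isometry A -> isometry (invmx A).
Proof.
move=> /andP[uA /forallP qA].
rewrite /isometry unitmx_inv uA; apply/forallP => v.
by rewrite -(eqP (qA _)) mulmxKV.
Qed.

Definition GO_plus := {A : 'M['F_2]_(n + n) | isometry A}.

HB.instance Definition _ := Finite.on GO_plus.

Implicit Types g h : GO_plus.

Definition GO_one : GO_plus := exist _ 1%:M isometry1.
Definition GO_mul g h : GO_plus :=
  exist _ (val g *m val h) (isometryM (valP g) (valP h)).
Definition GO_inv g : GO_plus := exist _ (invmx (val g)) (isometryV (valP g)).

Lemma GO_unit g : val g \in unitmx.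
Proof. by case/andP: (valP g). Qed.

Lemma GO_mulA : associative GO_mul.
Proof. by move=> g h k; apply: val_inj; apply: mulmxA. Qed.
Lemma GO_mul1 : left_id GO_one GO_mul.
Proof. by move=> g; apply: val_inj; apply: mul1mx. Qed.
Lemma GO_mulr1 : right_id GO_one GO_mul.
Proof. by move=> g; apply: val_inj; apply: mulmx1. Qed.
Lemma GO_mulV : left_inverse GO_one GO_inv GO_mul.
Proof. by move=> g; apply: val_inj; apply: mulVmx (GO_unit g). Qed.
Lemma GO_mulrV : right_inverse GO_one GO_inv GO_mul.
Proof. by move=> g; apply: val_inj; apply: mulmxV (GO_unit g). Qed.

HB.instance Definition _ := isGroup.Build GO_plus
  GO_mulA GO_mul1 GO_mulr1 GO_mulV GO_mulrV.

(* The Dickson invariant of [g] is the parity of the dimension of the image of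
   [g - 1] (Taylor, The Geometry of the Classical Groups, Chapter 11). *)
Definition dickson g : bool := odd (\rank (val g - 1%:M)).

Definition Omega_plus : set GO_plus := [set g | dickson g = false].

End Orthogonal.

(* The relators other than those presenting [S_n] and [SL(2, 2)]; a relation
   [x = y] is encoded as [x * y^-1], and "[g] centralises [sigma]" as
   [[~ sigma, g]]. *)
Definition relators n (H : groupType) (sigma Z U V : H) : seq H :=
     (if 3 < n then [:: [~ Z, U ^ (V ^+ 2)]; [~ Z, Z ^ (V ^+ 2)]] else [::])
  ++ (if 4 < n then [:: [~ Z, V * U * U ^ V]] else [::])
  ++ [:: Z ^+ 2;
         (Z * Z ^ V) * (Z ^ (U ^ V))^-1;
         [~ Z, U];
         [~ Z, Z ^ V]]
  ++ (if 3 < n then [:: [~ sigma, U ^ (V ^+ 2)]; [~ sigma, Z ^ (V ^+ 2)]]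
      else [::])
  ++ (if 4 < n then [:: [~ sigma, V * U * U ^ V]] else [::])
  ++ [:: [~ sigma, Z * U]]
  ++ [:: [~ sigma, sigma ^ V] * (sigma ^ (V * U))^-1;
         [~ sigma, sigma ^ (V * U)];
         [~ sigma, sigma ^ (U ^ (V * U))];
         [~ sigma, sigma ^ (Z ^ V)]]
  ++ (if 3 < n then [:: [~ sigma, sigma ^ (V ^+ 2)]] else [::])
  ++ (if n == 4 then [:: [~ sigma, sigma ^ (Z ^ V * V ^+ 2)]] else [::]).

Definition gen_sigma : free_group 4 := fg_gen (@Ordinal 4 0 isT).
Definition gen_Z : free_group 4 := fg_gen (@Ordinal 4 1 isT).
Definition gen_U : free_group 4 := fg_gen (@Ordinal 4 2 isT).
Definition gen_V : free_group 4 := fg_gen (@Ordinal 4 3 isT).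

(* [RS] is written in the letters [U, V] and [RL] in the letters [sigma, U]. *)
Definition Omega_relators n (RS RL : set (free_group 2)) :
    set (free_group 4) :=
  [set r | r \in relators n gen_sigma gen_Z gen_U gen_V]
  `|` fg_eval [tuple gen_U; gen_V] @` RS
  `|` fg_eval [tuple gen_sigma; gen_U] @` RL.

(* Main.v *)
From HB Require Import structures.
Require Import Defs.
From mathcomp Require Import all_boot all_order all_algebra all_fingroup.
From mathcomp Require Import boolp classical_sets.
From mathcomp Require Import zify ring.

Set Implicit Arguments.
Unset Strict Implicit.
Unset Printing Implicit Defensive.
Import GRing.Theory.

(** Let I be the set of the 2n signed indices, with e_a for a in I running
    through the hyperbolic basis and a -> neg a exchanging e_i and f_i.
    For a, b in I of different absolute values, the isometry x_ab : e_a ->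
    e_a + e_b, e_(neg b) -> e_(neg b) + e_(neg a) is a root element of
    type D_n; x_ab and x_(neg b, neg a) are the same, and sigma is x_01
    when points are numbered from 0. Since the field has two elements, the
    torus is trivial and the group is governed by its Weyl group and by
    its root elements of order 2.

    The isometries satisfy the relators (GO_relators, gens_relators). For
    the relators that present S_n and SL(2,2), which are not known
    explicitly, only the kernel of the natural map matters. So there is a
    homomorphism phi from the presented group G to the orthogonal group.

    Image. If g is an isometry and t a reflection, the fixed spaces of g
    and g t differ by exactly one dimension, so the Dickson invariant of a
    product of reflections is the parity of their number
    (dickson_reflection). The generators are products of evenly many
    reflections, so the image of phi is contained in the kernel of the
    Dickson invariant. Conversely, Gaussian elimination by root elements
    reduces every isometry to 1 or to one fixed reflection (elimination),
    and only the first can happen when the Dickson invariant vanishes.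

    Injectivity. In G, the element Z and S_n generate a subgroup W whose
    elements are even sign changes followed by permutations, and which phi
    maps faithfully to signed permutations (act_faithful). The stabiliser
    in W of the pair (0, 1) centralises sigma (sigma_stab), so the
    conjugates of sigma under W can be labelled as root elements x_ab of
    G, and W carries the few given commutator relations to all pairs of
    roots that are not opposite (x_add, x_src, x_opp, x_disj). The parity
    of sign changes leaves two orbits of W on triples for n = 3 and on
    quadruples for n = 4; for triples, the two labels of a root element
    link the orbits, and for n = 4 there is a relation for each of them.

    Let B be the subgroup generated by the positive root elements. The
    commutator relations and the relation s x s = x s x for a simple
    reflection s give the Bruhat decomposition G = B W B (cell_simple). If
    u w v is in the kernel of phi, then w acts both as a signed
    permutation and as a unitriangular matrix, so w = 1 (cell_kernel); and
    on B the matrix determines the element, one row at a time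
    (low_kernel). Hence phi is injective. *)

Local Open Scope group_scope.

(** * Preliminaries on permutations and groups *)

(** Multiplying s by the transposition of a moved point and its image
    reduces the number of moved points. The form of an induction principle
    serves for properties of the images of permutations in another group
    as well as for generation by adjacent transpositions. *)
Lemma sym_tail_ind n (P : {perm 'I_n} -> Prop) (k : nat) :
    P 1 -> (forall s t, P s -> P t -> P (s * t)) ->
    (forall i j : 'I_n, k <= i -> j = i.+1 :> nat -> P (tperm i j)) ->
  forall s : {perm 'I_n}, (forall i : 'I_n, i < k -> s i = i) -> P s.
Proof.
move=> P1 PM Padj.
have Ptr d (i j : 'I_n) : k <= i -> (j = i + d.+1 :> nat)%N -> P (tperm i j).
  elim: d i j => [|d IH] i j ki ji; first by apply: Padj => //; lia.
  have lt_l : (i + d.+1 < n)%N by have := ltn_ord j; lia.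
  pose l := Ordinal lt_l.
  have -> : tperm i j = tperm l j * tperm i l * tperm l j.
    have := tpermJ i l (tperm l j); rewrite conjgE tpermV tpermL tpermD ?mulgA //.
      by apply/eqP => /(congr1 val) /=; lia.
    by apply/eqP => /(congr1 val) /=; lia.
  have Plj : P (tperm l j) by apply: Padj => //=; lia.
  by apply: (PM _ _) => //; apply: (PM _ _) => //; apply: IH.
have Ptp (i j : 'I_n) : k <= i -> k <= j -> P (tperm i j).
  move=> ki kj; case: (ltngtP i j) => [ij|ji|/val_inj ->].
  - by apply: (Ptr (j - i).-1) => //; lia.
  - by rewrite tpermC; apply: (Ptr (i - j).-1) => //; lia.
  - by rewrite tperm1.
move=> s; move: {2}_.+1 (ltnSn #|[set x | s x != x]|) => m.
elim: m s => // m IH s lt_m fix_s.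
have [->//|/eqP s1] := pselect (s = 1).
have [i si] : exists i, s i != i.
  apply/existsP; rewrite -[X in is_true X]negbK; apply: contra s1.
  rewrite negb_exists => /forallP si; apply/eqP/permP => i.
  by have := si i; rewrite negbK perm1 => /eqP.
have ki : k <= i by rewrite leqNgt; apply: contra si => /fix_s ->.
have ksi : k <= s i.
  by rewrite leqNgt; apply: contra si => /fix_s /perm_inj ->.
rewrite -[s](mulgK (tperm i (s i))) tpermV; apply: (PM _ _); last exact: Ptp.
apply: IH => [|j jk]; last first.
  by rewrite permM (fix_s j) // tpermD //; apply/eqP => Ej; move: jk; rewrite -Ej ltnNge ?ki ?ksi.
rewrite ltnS in lt_m; apply: leq_trans lt_m; apply: proper_card; apply/properP; split.
  apply/fintype.subsetP => j; rewrite !inE permM; apply: contra => /eqP sj.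
  rewrite sj tpermD //; first by apply: contra si => /eqP ->; rewrite sj.
  by apply: contra si => /eqP E; rewrite -E in sj; rewrite (perm_inj sj).
by exists i; rewrite !inE // permM tpermR eqxx.
Qed.

Lemma perm_of_uniq_seqs (T : finType) (l1 l2 : seq T) :
  uniq l1 -> uniq l2 -> size l1 = size l2 -> exists s : {perm T}, map s l1 = l2.
Proof.
elim: l1 l2 => [|x l1 IH] [|y l2] //=; first by exists 1.
move=> /andP[xl1 u1] /andP[yl2 u2] [/IH[]// s Es].
exists (s * tperm (s x) y); rewrite permM tpermL -Es; congr cons.
apply/eq_in_map => z zl1; rewrite permM tpermD //.
  by apply: contraNneq xl1 => /perm_inj ->.
by apply: contraNneq yl2 => ->; rewrite -Es map_f.
Qed.

Lemma conjg_eq (G : groupType) (x y k : G) : x * k = k * y -> x ^ k = y.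
Proof. by move=> E; apply: (@mulgI G k); rewrite -conjgC. Qed.

Lemma commg_eq (G : groupType) (x y z : G) : x * y = y * x * z -> [~ x, y] = z.
Proof. by move=> E; apply: (@mulgI G (y * x)); rewrite -commgC. Qed.

Lemma conjg_commute (G : groupType) (x y : G) : commute x y -> x ^ y = x.
Proof. exact: conjg_eq. Qed.

Lemma commuteJ (G : groupType) (x y g : G) :
  commute x y -> commute (x ^ g) (y ^ g).
Proof. by move=> xy; rewrite /commute -!conjMg xy. Qed.

Lemma conjg_mul_commg (G : groupType) (y h : G) : y ^ h = y * [~ y, h].
Proof. by rewrite commgEl mulVKg. Qed.

Section CommutingInvolutions.
Variables (G : groupType) (T : eqType) (y : T -> G) (D : pred T).
Hypothesis y2 : forall a, D a -> y a * y a = 1.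
Hypothesis yC : forall a b, D a -> D b -> commute (y a) (y b).

Definition iprod (l : seq T) : G := \prod_(a <- l) y a.

Lemma iprod_nil : iprod [::] = 1. Proof. exact: big_nil. Qed.
Lemma iprod_cons a l : iprod (a :: l) = y a * iprod l.
Proof. exact: big_cons. Qed.
Lemma iprod_cat l1 l2 : iprod (l1 ++ l2) = iprod l1 * iprod l2.
Proof. exact: big_cat. Qed.

Lemma iprod_commute a l : D a -> all D l -> commute (y a) (iprod l).
Proof.
move=> Da; elim: l => [|b l IH] /=; first by rewrite iprod_nil => _; apply: commute1.
by move=> /andP[Db Dl]; rewrite iprod_cons; apply: commuteM; [apply: yC | apply: IH].
Qed.

Lemma iprod_rem a l : all D l -> a \in l -> iprod l = y a * iprod (rem a l).
Proof.
elim: l => //= b l IH /andP[Db Dl]; rewrite inE => /orP[/eqP -> | al].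
  by rewrite eqxx iprod_cons.
have Da := allP Dl a al.
case: eqP => [->|_]; first by rewrite iprod_cons.
by rewrite !iprod_cons (IH Dl al) !mulgA (yC Da Db).
Qed.

(** Commuting factors can be brought together and repeated ones cancel, so
    the elementary abelian 2-group spanned by the y a has square-free
    normal forms. This is used both for the sign changes of the Weyl group
    and for the rows of the unipotent subgroup. *)
Lemma iprod_uniq l : all D l ->
  exists l', [/\ uniq l', {subset l' <= l} & iprod l = iprod l'].
Proof.
elim: l => [|a l IH] /=; first by exists [::].
move=> /andP[Da Dl]; have [l' [u' s' E]] := IH Dl.
have Dl' : all D l' by apply/allP => b /s' /(allP Dl).
have [al'|al'] := boolP (a \in l').
  exists (rem a l'); split; first exact: rem_uniq.
    by move=> b /mem_rem /s' bl; rewrite inE bl orbT.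
  by rewrite iprod_cons E (iprod_rem Dl' al') mulgA y2 ?mul1g.
exists (a :: l'); split; rewrite /= ?al' //.
  by move=> b; rewrite !inE => /orP[->//|/s' ->]; rewrite orbT.
by rewrite !iprod_cons E.
Qed.

Lemma iprodK l : all D l -> iprod l * iprod l = 1.
Proof.
elim: l => [|a l IH] /=; first by rewrite iprod_nil mulg1.
move=> /andP[Da Dl]; rewrite iprod_cons {1}(iprod_commute Da Dl).
by rewrite -mulgA (mulgA (y a)) y2 // mul1g IH.
Qed.

End CommutingInvolutions.

Section Generated.
Variable G : groupType.
Implicit Types (S : G -> Prop) (g h y : G).

(** The generating sets to which this is applied consist of involutions,
    so the submonoid that they generate is a subgroup. *)
Inductive gen S : G -> Prop :=
| gen1 : gen S 1
| genL y g : S y -> gen S g -> gen S (y * g).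

Lemma gen_in S y : S y -> gen S y.
Proof. by move=> Sy; rewrite -[y]mulg1; apply: genL Sy (gen1 _). Qed.

Lemma gen_mul S g h : gen S g -> gen S h -> gen S (g * h).
Proof.
move=> Gg Gh; elim: Gg => [|y g' Sy _ IH]; first by rewrite mul1g.
by rewrite -mulgA; apply: genL.
Qed.

Lemma gen_sub S T g : (forall y, S y -> gen T y) -> gen S g -> gen T g.
Proof.
move=> ST; elim=> [|y g' Sy _ IH]; first exact: gen1.
by apply: gen_mul => //; apply: ST.
Qed.

Lemma gen_conj S h g : (forall y, S y -> gen S (y ^ h)) -> gen S g -> gen S (g ^ h).
Proof.
move=> SJ; elim=> [|y g' Sy _ IH]; first by rewrite conj1g; apply: gen1.
by rewrite conjMg; apply: gen_mul => //; apply: SJ.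
Qed.

Lemma gen_inv S g : (forall y, S y -> y * y = 1) -> gen S g -> gen S g^-1.
Proof.
move=> SK; elim=> [|y g' Sy _ IH]; first by rewrite invg1; apply: gen1.
rewrite invgM; apply: gen_mul => //.
have -> : y^-1 = y by apply/eqP; rewrite eq_sym -mulg_eq1 SK.
exact: gen_in.
Qed.

End Generated.

(** The kernel of f is a normal subgroup. *)
Lemma normal_closure_ker (G H : groupType) (R : set G) (f : UMagmaMorphism.type G H) :
  (forall r, R r -> f r = 1) -> forall r, normal_closure R r -> f r = 1.
Proof.
move=> fR; suff: (normal_closure R `<=` [set x | f x = 1])%classic by apply.
apply: smallest_sub => //.
split=> [|x y /= fx fy|x y /= fx] /=; first exact: gmulf1.
  by rewrite gmulfF fx fy divg1.
by rewrite gmulfJ fx conj1g.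
Qed.

Lemma fg_eval_comp (k : nat) (H K : groupType) (f : UMagmaMorphism.type H K) (g : k.-tuple H) a :
  f (fg_eval g a) = fg_eval (map_tuple f g) a.
Proof.
rewrite /fg_eval gmulf_prod; apply: eq_bigr => x _.
by rewrite /leval tnth_map; case: x.2 => //; rewrite gmulfV.
Qed.

Local Open Scope ring_scope.

(** * Root elements, reflections and permutations in the orthogonal group *)

Lemma F2_eq (x : 'F_2) : x = (x == 1)%:R.
Proof. by case: x => [[|[|//]] ?]; apply/eqP. Qed.

Lemma F2_neq0 (x : 'F_2) : (x != 0) = (x == 1).
Proof. by rewrite [x]F2_eq; case: (x == 1). Qed.

Lemma F2_neq1 (x : 'F_2) : x != 1 -> x = 0.
Proof. by rewrite {2}[x]F2_eq => /negPf ->. Qed.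

Lemma F2_addxx (x : 'F_2) : x + x = 0.
Proof. by rewrite [x]F2_eq; case: (x == 1); apply/eqP. Qed.

Lemma F2_addvv m n (v : 'M['F_2]_(m, n)) : v + v = 0.
Proof. by apply/matrixP => i j; rewrite !mxE F2_addxx. Qed.

Lemma F2_oppv m n (v : 'M['F_2]_(m, n)) : - v = v.
Proof. by apply/eqP; rewrite eq_sym -subr_eq0 opprK F2_addvv. Qed.

Lemma F2_sqr (x : 'F_2) : x * x = x.
Proof. by rewrite [x]F2_eq; case: (x == 1); apply/eqP. Qed.

(** Signed indices: (i, false) labels e_i and (i, true) labels f_i, so
    that e_a and e_(neg a) form a hyperbolic pair. *)
Definition sidx n : finType := ('I_n * bool)%type.

Definition neg n (a : sidx n) : sidx n := (a.1, ~~ a.2).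

Section SignedBasis.
Variable n : nat.
Implicit Types (a b c d : sidx n) (u v w : 'rV['F_2]_(n + n)).

Lemma negK : involutive (@neg n).
Proof. by case=> i b; rewrite /neg /= negbK. Qed.
Lemma neg_inj : injective (@neg n). Proof. exact: can_inj negK. Qed.
Lemma neg_neq a : neg a != a.
Proof. by case: a => i []; rewrite xpair_eqE andbC. Qed.
Lemma neg_eqF a : ((neg a == a) = false) * ((a == neg a) = false).
Proof. by rewrite [a == _]eq_sym (negPf (neg_neq a)). Qed.
Lemma sidx_neqF a b : a.1 != b.1 ->
  (((a == b) = false) * ((b == a) = false) * ((neg a == b) = false) *
   ((neg b == a) = false) * ((a == neg b) = false) * ((b == neg a) = false) *
   ((neg a == neg b) = false) * ((neg b == neg a) = false))%type.
Proof.
move=> ab; have ba : b.1 != a.1 by rewrite eq_sym.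
by do !split; apply/negP => /eqP/(congr1 fst) /= E; move: ab ba; rewrite E eqxx.
Qed.
Lemma sidx_cases a b : a.1 = b.1 -> a = b \/ a = neg b.
Proof. by case: a b => [i [|]] [j [|]] /= ->; [left|right|right|left]. Qed.

Definition pos a : 'I_(n + n) := if a.2 then rshift n a.1 else lshift n a.1.

Lemma pos_inj : injective pos.
Proof.
case=> [i [|]] [j [|]]; rewrite /pos /=.
- by move/rshift_inj ->.
- by move/eqP; rewrite eq_rlshift.
- by move/eqP; rewrite eq_lrshift.
- by move/lshift_inj ->.
Qed.

Lemma pos_onto (i : 'I_(n + n)) : exists a, i = pos a.
Proof.
case: (split_ordP i) => j ->; first by exists (j, false).
by exists (j, true).
Qed.

Definition co v a : 'F_2 := v 0 (pos a).
Definition bas a : 'rV['F_2]_(n + n) := delta_mx 0 (pos a).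

Lemma coD u v a : co (u + v) a = co u a + co v a. Proof. exact: mxE. Qed.
Lemma coZ x v a : co (x *: v) a = x * co v a. Proof. exact: mxE. Qed.
Lemma co0 a : co 0 a = 0. Proof. exact: mxE. Qed.
Lemma co_bas a b : co (bas a) b = (b == a)%:R.
Proof. by rewrite /co mxE eqxx (inj_eq pos_inj). Qed.

Lemma co_inj u v : co u =1 co v -> u = v.
Proof.
by move=> E; apply/rowP => i; have [a ->] := pos_onto i; apply: E.
Qed.

Lemma bas_inj : injective bas.
Proof.
move=> a b /(congr1 (fun v => co v a)); rewrite !co_bas eqxx.
by case: (a =P b) => // _ /eqP.
Qed.

Lemma big_pos (R : nmodType) (F : 'I_(n + n) -> R) :
  \sum_i F i = \sum_a F (pos a).
Proof.
rewrite big_split_ord /= -(pair_bigA _ (fun (i : 'I_n) (e : bool) => F (pos (i, e)))) /=.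
rewrite -big_split; apply: eq_bigr => i _.
by rewrite big_bool; apply: addrC.
Qed.

Lemma row_bas v : v = \sum_a co v a *: bas a.
Proof. by rewrite [LHS]row_sum_delta big_pos. Qed.

Lemma mx_bas_inj m (A B : 'M['F_2]_(n + n, m)) :
  (forall a, bas a *m A = bas a *m B) -> A = B.
Proof.
by move=> E; apply/row_matrixP => i; have [a ->] := pos_onto i; rewrite !rowE; apply: E.
Qed.

Definition dot u v : 'F_2 := \sum_a co u a * co v (neg a).

Lemma dotC u v : dot u v = dot v u.
Proof.
rewrite /dot (reindex_inj neg_inj); apply: eq_bigr => a _.
by rewrite negK mulrC.
Qed.

Lemma dotDl u v w : dot (u + v) w = dot u w + dot v w.
Proof. by rewrite -big_split; apply: eq_bigr => a _; rewrite coD mulrDl. Qed.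
Lemma dotZl x u w : dot (x *: u) w = x * dot u w.
Proof. by rewrite /dot mulr_sumr; apply: eq_bigr => a _; rewrite coZ mulrA. Qed.
Lemma dotDr u v w : dot w (u + v) = dot w u + dot w v.
Proof. by rewrite dotC dotDl !(dotC w). Qed.
Lemma dotZr x u w : dot w (x *: u) = x * dot w u.
Proof. by rewrite dotC dotZl (dotC w). Qed.

Lemma dot_bas u a : dot u (bas a) = co u (neg a).
Proof.
rewrite /dot (bigD1 (neg a)) //= co_bas negK eqxx mulr1 big1 ?addr0 // => b ba.
by rewrite co_bas -(inj_eq neg_inj) negK (negPf ba) mulr0.
Qed.

Lemma dot_nondeg u : (forall v, dot u v = 0) -> u = 0.
Proof.
by move=> u0; apply: co_inj => a; rewrite co0 -[a]negK -dot_bas.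
Qed.

Lemma hyp_quadE v : hyp_quad v = \sum_i co v (i, false) * co v (i, true).
Proof. by []. Qed.

Lemma hyp_quadD u v : hyp_quad (u + v) = hyp_quad u + hyp_quad v + dot u v.
Proof.
rewrite !hyp_quadE /dot -(pair_bigA _ (fun (i : 'I_n) (e : bool) => co u (i, e) * co v (i, ~~ e))) /=.
rewrite -!big_split /=; apply: eq_bigr => i _.
rewrite big_bool /= !coD; ring.
Qed.

Lemma hyp_quadZ x v : hyp_quad (x *: v) = x * hyp_quad v.
Proof.
rewrite !hyp_quadE mulr_sumr; apply: eq_bigr => i _.
by rewrite !coZ -{3}[x]F2_sqr; ring.
Qed.

Lemma hyp_quad_bas a : hyp_quad (bas a) = 0.
Proof.
rewrite hyp_quadE big1 // => i _; rewrite !co_bas.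
by case: a => j []; rewrite !xpair_eqE ?andbF ?mul0r ?mulr0.
Qed.

Lemma dot_diag v : dot v v = 0.
Proof.
have := hyp_quadD v v; rewrite !F2_addvv F2_addxx add0r => <-.
by rewrite -(scale0r 0) hyp_quadZ mul0r.
Qed.

Lemma isometry_dot (A : 'M['F_2]_(n + n)) :
  (forall v, hyp_quad (v *m A) = hyp_quad v) ->
  forall u v, dot (u *m A) (v *m A) = dot u v.
Proof.
move=> QA u v; have := QA (u + v); rewrite mulmxDl !hyp_quadD !QA.
by move/addrI.
Qed.

(** Invertibility is automatic: the polar form is preserved as well, and
    it is nondegenerate. *)
Lemma isometryI (A : 'M['F_2]_(n + n)) :
  (forall v, hyp_quad (v *m A) = hyp_quad v) -> Defs.isometry A.
Proof.
move=> QA; rewrite /Defs.isometry; apply/andP; split; last by apply/forallP => v; rewrite QA.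
rewrite -row_free_unit; apply/row_freeP.
apply/row_freeP/inj_row_free => v vA; apply: dot_nondeg => w.
by rewrite -(isometry_dot QA) vA /dot big1 // => a _; rewrite co0 mul0r.
Qed.

Implicit Types g h : GO_plus n.

Lemma GO_quad g v : hyp_quad (v *m val g) = hyp_quad v.
Proof. by have /andP[_ /forallP/(_ v)/eqP] := valP g. Qed.

Lemma GO_dot g u v : dot (u *m val g) (v *m val g) = dot u v.
Proof. exact: isometry_dot (GO_quad g) _ _. Qed.

Lemma GO_valM g h : val (g * h)%g = val g *m val h. Proof. by []. Qed.
Lemma GO_val1 : val (1%g : GO_plus n) = 1%:M. Proof. by []. Qed.

Lemma GO_inj g h : (forall a, bas a *m val g = bas a *m val h) -> g = h.
Proof. by move=> E; apply/val_inj/mx_bas_inj. Qed.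

Definition xmx a b : 'M['F_2]_(n + n) :=
  1%:M + delta_mx (pos a) (pos b) + delta_mx (pos (neg b)) (pos (neg a)).

Lemma mul_delta_row v (i j : 'I_(n + n)) : v *m delta_mx i j = v 0 i *: delta_mx 0 j.
Proof.
apply/rowP => k; rewrite !mxE (bigD1 i) //= mxE eqxx /= big1 ?addr0 // => l li.
by rewrite mxE (negPf li) mulr0.
Qed.

Lemma mul_xmx a b v :
  v *m xmx a b = v + co v a *: bas b + co v (neg b) *: bas (neg a).
Proof. by rewrite !mulmxDr mulmx1 !mul_delta_row. Qed.

Lemma xmx_isometry a b : a.1 != b.1 -> Defs.isometry (xmx a b).
Proof.
move=> ab; apply: isometryI => v.
rewrite mul_xmx !hyp_quadD !hyp_quadZ !hyp_quad_bas !dotDl !dotZr !dotZl !dot_bas.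
rewrite !negK co_bas.
have -> : (a == b) = false by apply: contraNF ab => /eqP ->.
rewrite !mulr0 !addr0 mulrC -addrA F2_addxx addr0 //.
Qed.

(** The root element e_a -> e_a + e_b, e_(neg b) -> e_(neg b) + e_(neg a),
    with a junk value when a and b have the same absolute value. It is
    locked, as are the other isometries below, because unification would
    otherwise unfold it down to matrix entries. *)
Definition Gx : sidx n -> sidx n -> GO_plus n :=
  locked (fun a b => insubd (1%g : GO_plus n) (xmx a b)).

Lemma val_Gx a b : a.1 != b.1 -> val (Gx a b) = xmx a b.
Proof. by move=> ab; rewrite /Gx -lock insubdK //; apply: xmx_isometry. Qed.

Lemma mul_Gx a b v : a.1 != b.1 ->
  v *m val (Gx a b) = v + co v a *: bas b + co v (neg b) *: bas (neg a).
Proof. by move=> ab; rewrite val_Gx // mul_xmx. Qed.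

Lemma co_Gx a b v c : a.1 != b.1 -> co (v *m val (Gx a b)) c =
  co v c + co v a * (c == b)%:R + co v (neg b) * (c == neg a)%:R.
Proof. by move=> ab; rewrite mul_Gx // 2!coD 2!coZ 2!co_bas. Qed.

Lemma Gx_neg a b : Gx (neg b) (neg a) = Gx a b.
Proof. by rewrite /Gx -lock /xmx !negK addrAC. Qed.

Definition tmx u : 'M['F_2]_(n + n) := \matrix_(i, j) (1%:M i j + dot (delta_mx 0 i) u * u 0 j).

Lemma mul_tmx u v : v *m tmx u = v + dot v u *: u.
Proof.
apply/rowP => j; rewrite !mxE.
under eq_bigr do rewrite mxE mulrDr mulrA.
rewrite big_split /= -[X in X + _ = _]/((\sum_i v 0 i * (1%:M : 'M_(n + n)) i j)).
have -> : \sum_i v 0 i * (1%:M : 'M_(n + n)) i j = v 0 j.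
  by have := mulmx1 v => /rowP/(_ j); rewrite mxE.
congr (_ + _); rewrite -mulr_suml; congr (_ * _).
rewrite big_pos; under eq_bigr => a _ do rewrite dotC dot_bas mulrC.
rewrite dotC /dot (reindex_inj neg_inj); apply: eq_bigr => a _.
by rewrite negK.
Qed.

Lemma tmx_isometry u : hyp_quad u = 1 -> Defs.isometry (tmx u).
Proof.
move=> Qu; apply: isometryI => v.
rewrite mul_tmx hyp_quadD hyp_quadZ dotZr Qu mulr1 F2_sqr -addrA F2_addxx addr0 //.
Qed.

(** The reflection (orthogonal transvection) v -> v + (v.u) u. *)
Definition Gt : 'rV['F_2]_(n + n) -> GO_plus n :=
  locked (fun u => insubd (1%g : GO_plus n) (tmx u)).

Lemma mul_Gt u v : hyp_quad u = 1 -> v *m val (Gt u) = v + dot v u *: u.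
Proof. by move=> ?; rewrite /Gt -lock insubdK ?mul_tmx //; apply: tmx_isometry. Qed.

(** A permutation of the indices acts in the same way on the e_i and on
    the f_i. *)
Definition smx (s : 'S_n) : 'M['F_2]_(n + n) :=
  \sum_a delta_mx (pos a) (pos (s a.1, a.2)).

Lemma mul_smx s v : v *m smx s = \sum_a co v a *: bas (s a.1, a.2).
Proof. by rewrite mulmx_sumr; apply: eq_bigr => a _; rewrite mul_delta_row. Qed.

Lemma co_smx s v a : co (v *m smx s) (s a.1, a.2) = co v a.
Proof.
rewrite mul_smx /co summxE (bigD1 a) //= big1 => [|b ba].
  by rewrite mxE -[X in _ * X + _]/(co (bas _) _) co_bas eqxx mulr1 addr0.
rewrite mxE -[X in _ * X]/(co (bas _) _) co_bas xpair_eqE (inj_eq perm_inj).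
by case: a b ba => i x [j y]; rewrite xpair_eqE ![j == _]eq_sym ![y == _]eq_sym => /negPf ->; rewrite mulr0.
Qed.

Lemma bas_smx s a : bas a *m smx s = bas (s a.1, a.2).
Proof.
rewrite mul_smx (bigD1 a) //= big1 => [|b ba].
  by rewrite co_bas eqxx scale1r addr0.
by rewrite co_bas (negPf ba) scale0r.
Qed.

Lemma smx_isometry s : Defs.isometry (smx s).
Proof.
apply: isometryI => v; rewrite !hyp_quadE (reindex_inj (@perm_inj _ s)).
by apply: eq_bigr => i _; rewrite !(co_smx _ _ (i, _)).
Qed.

Definition Gs : 'S_n -> GO_plus n :=
  locked (fun s => exist _ (smx s) (smx_isometry s)).

Lemma bas_Gs s a : bas a *m val (Gs s) = bas (s a.1, a.2).
Proof. by rewrite /Gs -lock; apply: bas_smx. Qed.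

Lemma GsM s t : Gs (s * t) = (Gs s * Gs t)%g.
Proof. by apply: GO_inj => a; rewrite GO_valM mulmxA !bas_Gs permM. Qed.

Lemma Gs1 : Gs 1 = 1%g.
Proof. by apply: GO_inj => a; rewrite bas_Gs mulmx1 perm1; case: a. Qed.

HB.instance Definition _ :=
  isUMagmaMorphism.Build 'S_n (GO_plus n) Gs (conj Gs1 GsM).

End SignedBasis.

Arguments neg_inj {n}.
Arguments pos_inj {n}.
Arguments bas_inj {n}.

Section OrthogonalRelations.
Variable n : nat.
Implicit Types (a b c d : sidx n) (u v w : 'rV['F_2]_(n + n)) (g h : GO_plus n).

Lemma GO_ext g h : (forall v, v *m val g = v *m val h) -> g = h.
Proof. by move=> E; apply: GO_inj => a. Qed.

Lemma GO_conjP g h k :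
  (forall v, v *m val g *m val k = v *m val k *m val h) -> (g ^ k)%g = h.
Proof.
move=> E; apply: conjg_eq; apply: GO_ext => v.
by rewrite !GO_valM !mulmxA E.
Qed.

(** With p = e_b and q = e_(neg a) a root element is v -> v + (v.q) p +
    (v.p) q; in this form conjugation by an isometry just moves p and q. *)
Lemma mul_Gx_dot a b v : a.1 != b.1 -> v *m val (Gx a b) =
  v + dot v (bas (neg a)) *: bas b + dot v (bas b) *: bas (neg a).
Proof. by move=> ab; rewrite mul_Gx // !dot_bas negK. Qed.

Lemma GxJ a b c d g : a.1 != b.1 -> c.1 != d.1 ->
    bas (neg a) *m val g = bas (neg c) -> bas b *m val g = bas d ->
  (Gx a b ^ g)%g = Gx c d.
Proof.
move=> ab cd ac bd; apply: GO_conjP => v.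
by rewrite !mul_Gx_dot // !mulmxDl -!scalemxAl ac bd -[bas (neg c)]ac -[bas d]bd !GO_dot.
Qed.

Lemma GtK u : hyp_quad u = 1 -> (Gt u * Gt u = 1)%g.
Proof.
move=> Qu; apply: GO_ext => v; rewrite GO_valM mulmxA !mul_Gt // mulmx1.
by rewrite dotDl dotZl dot_diag mulr0 addr0 -addrA F2_addvv addr0.
Qed.

Lemma GO_commute g h :
  (forall v, v *m val g *m val h = v *m val h *m val g) -> commute g h.
Proof.
move=> E; have gh : (g * h)%g = (h * g)%g; last exact gh.
by apply: GO_ext => v; rewrite !GO_valM !mulmxA E.
Qed.

Lemma GxK a b : a.1 != b.1 -> (Gx a b * Gx a b = 1)%g.
Proof.
move=> ab; apply: GO_ext => v; apply: co_inj => e.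
rewrite GO_valM mulmxA mulmx1 !co_Gx // !(sidx_neqF ab, neg_eqF, mulr0, addr0).
(* The terms that cancel in characteristic 2 are added explicitly. *)
rewrite -[RHS]addr0 -(F2_addxx (co v a * (e == b)%:R + co v (neg b) * (e == neg a)%:R)).
by ring.
Qed.

(** The four inequations say that the nilpotent parts of the two matrices
    annihilate each other in both orders. *)
Lemma GxC a b c d : a.1 != b.1 -> c.1 != d.1 ->
  b != c -> b != neg d -> a != d -> a != neg c -> commute (Gx a b) (Gx c d).
Proof.
move=> ab cd bc bd ad ac; apply: GO_commute => v; apply: co_inj => e.
have e1 : (c == b) = false by rewrite eq_sym (negPf bc).
have e2 : (c == neg a) = false by rewrite eq_sym -(inj_eq neg_inj) negK (negPf ac).
have e3 : (neg d == b) = false by rewrite eq_sym (negPf bd).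
have e4 : (neg d == neg a) = false by rewrite (inj_eq neg_inj) eq_sym (negPf ad).
have e5 : (neg b == d) = false by rewrite -(inj_eq neg_inj) negK (negPf bd).
have e6 : (neg b == neg c) = false by rewrite (inj_eq neg_inj) (negPf bc).
rewrite !(co_Gx _ _ ab, co_Gx _ _ cd) e1 e2 e3 e4 e5 e6 (negPf ad) (negPf ac).
by rewrite !mulr0 !addr0; ring.
Qed.

(** Both products of the nilpotent parts equal the matrix unit that maps
    e_a to e_(neg a). *)
Lemma Gx_opp a b : a.1 != b.1 -> commute (Gx a b) (Gx a (neg b)).
Proof.
move=> ab; apply: GO_commute => v; apply: co_inj => e.
have ab' : a.1 != (neg b).1 by [].
rewrite !(co_Gx _ _ ab', co_Gx _ _ ab) negK.
by rewrite !(sidx_neqF ab, neg_eqF, eqxx) !mulr0 !addr0; ring.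
Qed.

Lemma GxR a b c : a.1 != b.1 -> a.1 != c.1 -> b.1 != c.1 ->
  [~ Gx a b, Gx b c]%g = Gx a c.
Proof.
move=> ab ac bc; apply: commg_eq; apply: GO_ext => v; apply: co_inj => e.
rewrite !GO_valM !mulmxA !(co_Gx _ _ ab, co_Gx _ _ ac, co_Gx _ _ bc).
rewrite !(sidx_neqF ab, sidx_neqF ac, sidx_neqF bc, eqxx, neg_eqF) !(mulr0, mulr1, addr0).
rewrite -[LHS]addr0 -(F2_addxx (co v (neg c) * (e == neg a)%:R)).
by ring.
Qed.

(** A root element is a product of four reflections. Let p and q span a
    totally singular line and let u be nonsingular and orthogonal to both;
    then the reflections in u, u + p, u + q and u + p + q compose to v ->
    v + (v.q) p + (v.p) q. It takes a third index to find u, and this is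
    where n > 2 is needed for the Dickson invariant. *)
Lemma Gx_refl a b c : a.1 != b.1 -> c.1 != a.1 -> c.1 != b.1 ->
  let u := bas c + bas (neg c) in
  [/\ hyp_quad u = 1, hyp_quad (u + bas b) = 1, hyp_quad (u + bas (neg a)) = 1 &
      hyp_quad (u + bas b + bas (neg a)) = 1] /\
  Gx a b = (Gt u * Gt (u + bas b) * Gt (u + bas (neg a)) * Gt (u + bas b + bas (neg a)))%g.
Proof.
move=> ab ca cb u.
have simp := (dotDl, dotDr, dotZl, dotZr, dot_bas, coD, coZ, co_bas, negK, sidx_neqF ab, sidx_neqF ca, sidx_neqF cb, eqxx, neg_eqF).
have Qu : hyp_quad u = 1.
  by rewrite /u hyp_quadD !hyp_quad_bas dot_bas negK co_bas eqxx !add0r.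
have Q1 : hyp_quad (u + bas b) = 1.
  by rewrite hyp_quadD Qu hyp_quad_bas dot_bas /u !simp !addr0.
have Q2 : hyp_quad (u + bas (neg a)) = 1.
  by rewrite hyp_quadD Qu hyp_quad_bas dot_bas /u !simp !addr0.
have Q3 : hyp_quad (u + bas b + bas (neg a)) = 1.
  by rewrite hyp_quadD Q1 hyp_quad_bas dot_bas /u !simp !addr0.
have du : dot u u = 0 := dot_diag u.
have ub : dot u (bas b) = 0 by rewrite /u !simp addr0.
have ua : dot u (bas (neg a)) = 0 by rewrite /u !simp addr0.
have ba : dot (bas b) (bas (neg a)) = 0 by rewrite !simp.
have [bu au] : dot (bas b) u = 0 /\ dot (bas (neg a)) u = 0 by rewrite !(dotC _ u).
have ab' : dot (bas (neg a)) (bas b) = 0 by rewrite dotC.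
split=> //; clearbody u.
apply: GO_ext => v; rewrite !GO_valM !mulmxA (mul_Gx_dot _ ab).
rewrite (mul_Gt _ Qu) (mul_Gt _ Q1) (mul_Gt _ Q2) (mul_Gt _ Q3).
rewrite !(dotDl, dotDr, dotZl, dotZr).
rewrite !(du, ub, ua, ba, bu, au, ab', dot_diag) !(mulr0, addr0).
apply: co_inj => e; rewrite !(coD, coZ).
set vu := dot v u; set vb := dot v (bas b); set va := dot v (bas (neg a)).
set s := co u e; set t := co (bas b) e; set r := co (bas (neg a)) e.
rewrite -[LHS]addr0 -(F2_addxx ((vu + vu + va + vb) * s + (vu + vb) * t + (vu + va) * r)); ring.
Qed.

(** The usual expression of a Weyl reflection by root elements, without
    signs because the field has two elements. *)
Lemma Gs_tperm (i j : 'I_n) : i != j ->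
  Gs (tperm i j) = (Gx (i, false) (j, false) * Gx (j, false) (i, false) * Gx (i, false) (j, false))%g.
Proof.
move=> ij; apply: GO_inj => -[k e]; rewrite !GO_valM !mulmxA bas_Gs /=.
have ji : j != i by rewrite eq_sym.
have [ijF jiF] := (negPf ij, negPf ji).
have E1 v := mul_Gx v (ij : ((i, false) : sidx n).1 != ((j, false) : sidx n).1).
have E2 v := mul_Gx v (ji : ((j, false) : sidx n).1 != ((i, false) : sidx n).1).
rewrite !E1 !E2 /neg /= !coD !coZ !co_bas !xpair_eqE !eqxx ijF jiF.
case: tpermP => [->|->|/eqP/negPf ki /eqP/negPf kj]; case: e => /=;
  rewrite ?eqxx ?ijF ?jiF ?(eq_sym _ k) ?ki ?kj /=.
all: rewrite !(mulr0, mul0r, mulr1, addr0, add0r, scale0r, scale1r, F2_addxx) //.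
all: try by rewrite addrAC F2_addvv add0r.
Qed.

End OrthogonalRelations.

(** * The Dickson invariant counts reflections modulo 2 *)

Section Dickson.
Variable n : nat.
Implicit Types (a b c d : sidx n) (u v w : 'rV['F_2]_(n + n)) (g h : GO_plus n).

Local Notation ker g := (kermx (val g - 1%:M)).

Lemma ker_fixed g v : (v <= ker g)%MS = (v *m val g == v).
Proof. by rewrite sub_kermx mulmxBr mulmx1 subr_eq0. Qed.

(** The fixed space of g grows by w: since w g = w + u is as singular as
    w, the form gives w.u = 1, so the reflection in u brings w + u back to
    w. The old fixed vectors are orthogonal to u and stay fixed. *)
Lemma rank_ker_reflection g u w : hyp_quad u = 1 -> w *m val g = w + u ->
  \rank (ker (g * Gt u)%g) = (\rank (ker g)).+1.
Proof.
move=> Qu wg.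
have wu : dot w u = 1.
  have := GO_quad g w; rewrite wg hyp_quadD Qu -addrA -[RHS]addr0 => /addrI.
  by rewrite [dot w u]F2_eq; case: (_ == 1) => // /eqP.
have kg v : v *m val g = v -> dot v u = 0.
  move=> vg; have := GO_dot g v w; rewrite vg wg dotDr -[RHS]addr0.
  exact: addrI.
have u0 : u != 0 by apply/eqP => u0; move/eqP: wu; rewrite u0 -(scale0r 0) dotZr mul0r.
have w_ker : (w <= ker (g * Gt u)%g)%MS.
  rewrite ker_fixed GO_valM mulmxA wg mul_Gt // dotDl wu dot_diag addr0 scale1r.
  by rewrite -addrA F2_addvv addr0.
have w_nker : ~~ (w <= ker g)%MS.
  by rewrite ker_fixed wg -subr_eq0 addrAC subrr add0r.
have sub : (ker g <= ker (g * Gt u)%g)%MS.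
  apply/rV_subP => v; rewrite !ker_fixed GO_valM mulmxA mul_Gt // => /eqP vg.
  by rewrite vg kg // scale0r addr0.
apply/eqP; rewrite eqn_leq; apply/andP; split; last first.
  apply: rank_ltmx; rewrite /ltmx sub; apply: contra w_nker => le.
  exact: submx_trans w_ker le.
suff le : (ker (g * Gt u)%g <= ker g + w)%MS.
  apply: leq_trans (mxrankS le) _; apply: leq_trans (mxrank_adds_leqif _ _) _.
  by rewrite -[leqRHS]addn1 leq_add2l rank_leq_row.
apply/rV_subP => v; rewrite ker_fixed GO_valM mulmxA => /eqP vg.
have {}vg : v *m val g = v + dot v u *: u.
  by rewrite -mul_Gt // -[in RHS]vg -mulmxA -GO_valM GtK // mulmx1.
have [vu|vu] := eqVneq (dot v u) 0.
  apply: submx_trans (addsmxSl _ _); rewrite ker_fixed.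
  by rewrite vg vu scale0r addr0.
have {}vu : dot v u = 1 by apply/eqP; rewrite -F2_neq0.
rewrite -[v]addr0 -(F2_addvv w) addrA; apply: addmx_sub_adds; last exact: submx_refl.
rewrite ker_fixed mulmxDl vg wg vu scale1r.
by rewrite addrACA F2_addvv addr0.
Qed.

(** The image of g - 1 is the orthogonal complement of the fixed space of
    g. If u is not in it, some fixed vector k of g has k.u = 1, and then g
    followed by the reflection in u maps k to k + u. *)
Lemma reflection_moved g u : hyp_quad u = 1 ->
  (exists w, w *m val g = w + u) \/ (exists w, w *m val (g * Gt u)%g = w + u).
Proof.
move=> Qu; have [/submxP[D uD]|nu] := boolP (u <= val g - 1%:M)%MS.
  by left; exists D; rewrite uD mulmxBr mulmx1 addrC subrK.
right; move: nu; rewrite submxE => /rV0Pn[j uj].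
(* The functional c vanishes on the image of g - 1 but not at u; k is the
   vector that represents it. *)
pose c := col j (cokermx (val g - 1%:M)).
pose k := \sum_a c (pos a) 0 *: bas (neg a).
have dk v : dot v k = (v *m c) 0 0.
  rewrite mxE big_pos /k; apply: etrans (_ : \sum_a dot v (c (pos a) 0 *: bas (neg a)) = _).
    elim/big_rec2: _ => [|a x y _ <-]; last by rewrite dotDr.
    by rewrite -(scale0r 0) dotZr mul0r.
  by apply: eq_bigr => a _; rewrite dotZr dot_bas negK mulrC.
have c0 : (val g - 1%:M) *m c = 0.
  by rewrite /c colE mulmxA mulmx_coker mul0mx.
have kg : k *m val g = k.
  apply/eqP; rewrite -subr_eq0 F2_oppv; apply/eqP/dot_nondeg => v.
  have -> : v = v *m val (g^-1)%g *m val g by rewrite -mulmxA -GO_valM mulVg mulmx1.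
  set v' := v *m _.
  rewrite dotC dotDr GO_dot -dotDl dk -[v' in v' + _]mulmx1 addrC -mulmxDr.
  by rewrite -[1%:M]F2_oppv -mulmxA c0 mulmx0 mxE.
exists k; rewrite GO_valM mulmxA kg mul_Gt // dotC dk.
suff -> : (u *m c) 0 0 = 1 by rewrite scale1r.
by apply/eqP; rewrite -F2_neq0 /c colE mulmxA -colE mxE.
Qed.

Lemma odd_rank_ker g : odd (\rank (ker g)) = dickson g.
Proof.
rewrite /dickson mxrank_ker oddB ?rank_leq_row //.
by rewrite [odd (n + n)]oddD addbb.
Qed.

(** In each case of the preceding lemma the fixed space of one of the two
    isometries has one dimension more than that of the other. *)
Lemma dickson_reflection g u : hyp_quad u = 1 ->
  dickson (g * Gt u)%g = ~~ dickson g.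
Proof.
move=> Qu; rewrite -!odd_rank_ker; case: (reflection_moved g Qu) => -[w].
  by move/(rank_ker_reflection Qu) ->.
move/(rank_ker_reflection Qu); rewrite -mulgA GtK // mulg1 => ->.
by rewrite /= negbK.
Qed.

Definition refl_prod (b : bool) g := exists us,
  [/\ all (fun u => hyp_quad u == 1) us, odd (size us) = b & g = (\prod_(u <- us) Gt u)%g].

(** This makes the Dickson invariant computable without knowing that it is
    a homomorphism on the whole orthogonal group. *)
Lemma refl_prod_dickson (e : bool) g : refl_prod e g -> dickson g = e.
Proof.
case=> us [Qus <- ->]; elim/last_ind: us Qus => [|us u IH].
  by rewrite big_nil /dickson GO_val1 subrr mxrank0.
rewrite all_rcons => /andP[/eqP Qu /IH E].
have -> : (\prod_(u <- rcons us u) Gt u = (\prod_(u <- us) Gt u) * Gt u)%g.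
  by rewrite -cats1 big_cat big_seq1.
by rewrite dickson_reflection // E size_rcons.
Qed.

Lemma refl_prod1 : refl_prod false 1%g.
Proof. by exists [::]; rewrite big_nil. Qed.

Lemma refl_prodM (e f : bool) g h :
  refl_prod e g -> refl_prod f h -> refl_prod (e (+) f) (g * h)%g.
Proof.
move=> [us [Qus <- ->]] [vs [Qvs <- ->]]; exists (us ++ vs).
by rewrite all_cat Qus Qvs size_cat oddD big_cat.
Qed.

Lemma refl_prodV (e : bool) g : refl_prod e g -> refl_prod e (g^-1)%g.
Proof.
case=> us [Qus <- ->]; exists (rev us); split.
- by rewrite all_rev.
- by rewrite size_rev.
elim: us Qus => [|u us IH] /=; first by rewrite !big_nil invg1.
move=> /andP[/eqP Qu /IH E].
rewrite rev_cons -cats1 big_cat big_seq1 big_cons invgM E; congr (_ * _)%g.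
by apply/eqP; rewrite eq_sym -mulg_eq1 GtK.
Qed.

Lemma refl_prod_Gt u : hyp_quad u = 1 -> refl_prod true (Gt u).
Proof. by move=> Qu; exists [:: u]; rewrite big_seq1 /= Qu eqxx. Qed.

Lemma third_index (i j : 'I_n) : (2 < n)%N -> exists k, k != i /\ k != j.
Proof.
move=> hn.
have : (0 < #|~: [set i; j]|)%N.
  by have := cardsC [set i; j]; rewrite card_ord cards2; case: (i != j) => /=; lia.
by case/card_gt0P => k; rewrite !inE negb_or => /andP[]; exists k.
Qed.

Lemma refl_prod_Gx a b : (2 < n)%N -> a.1 != b.1 -> refl_prod false (Gx a b).
Proof.
move=> hn ab; have [k [ka kb]] := third_index a.1 b.1 hn.
have [[Q1 Q2 Q3 Q4] ->] := @Gx_refl _ a b (k, false) ab ka kb.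
apply: (@refl_prodM true true); last exact: refl_prod_Gt.
apply: (@refl_prodM false true); last exact: refl_prod_Gt.
by apply: (@refl_prodM true true); apply: refl_prod_Gt.
Qed.

Lemma refl_prod_Gs s : (2 < n)%N -> refl_prod false (Gs s).
Proof.
move=> hn; apply: (@sym_tail_ind _ (fun s => refl_prod false (Gs s)) 0) => //.
- by rewrite Gs1; apply: refl_prod1.
- by move=> {}s t Es Et; rewrite GsM; apply: (refl_prodM Es Et).
move=> i j _ ji; have ij : i != j by apply/eqP => E; move: ji; rewrite E; lia.
rewrite Gs_tperm //; apply: (@refl_prodM false false); last exact: refl_prod_Gx.
by apply: (@refl_prodM false false); apply: refl_prod_Gx => //=; rewrite eq_sym.
Qed.

End Dickson.

(** * Elimination by root elements *)

Section Elimination.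
Variable n : nat.
Implicit Types (a b c d : sidx n) (u v w : 'rV['F_2]_(n + n)) (g h : GO_plus n).

Variable S : GO_plus n -> Prop.
Hypothesis S1 : S 1%g.
Hypothesis SM : forall g h, S g -> S h -> S (g * h)%g.
Hypothesis SV : forall g, S g -> S (g^-1)%g.
Hypothesis Sx : forall a b, a.1 != b.1 -> S (Gx a b).

Definition low (k : nat) h := S h /\ forall a, (k < a.1)%N -> bas a *m val h = bas a.

Definition supp (k : nat) v := forall a, (k < a.1)%N -> co v a = 0.

Lemma lowM k g h : low k g -> low k h -> low k (g * h)%g.
Proof.
move=> [Sg Fg] [Sh Fh]; split; first exact: SM.
by move=> a ka; rewrite GO_valM mulmxA Fg ?Fh.
Qed.

Lemma low_Gx k a b : a.1 != b.1 -> (a.1 <= k)%N -> (b.1 <= k)%N -> low k (Gx a b).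
Proof.
move=> ab ak bk; split=> [|c kc]; first exact: Sx.
have ca : a.1 != c.1 by apply/eqP => E; move: kc; rewrite -E; lia.
have cb : b.1 != c.1 by apply/eqP => E; move: kc; rewrite -E; lia.
by rewrite mul_Gx // !co_bas !(sidx_neqF ca, sidx_neqF cb) !scale0r !addr0.
Qed.

Lemma low_supp k g v : (forall a, (k < a.1)%N -> bas a *m val g = bas a) ->
  supp k v -> supp k (v *m val g).
Proof.
move=> Fg sv a ka; rewrite -[a]negK -dot_bas -(Fg (neg a)) // GO_dot dot_bas.
exact: sv.
Qed.

(** The quadratic form of e_c + t e_(neg c) is t. *)
Lemma singular_support v c : (forall a, a.1 != c.1 -> co v a = 0) ->
  hyp_quad v = 0 -> co v c = 1 -> v = bas c.
Proof.
move=> sv Qv vc; have Ev : v = bas c + co v (neg c) *: bas (neg c).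
  apply: co_inj => a; rewrite coD coZ !co_bas.
  have [ac|ac] := eqVneq a.1 c.1; last by rewrite sv // !(sidx_neqF ac) mulr0 addr0.
  by case: (sidx_cases ac) => ->; rewrite !(eqxx, neg_eqF) ?vc ?mulr0 ?addr0 ?mulr1 ?add0r.
move: Qv; rewrite Ev hyp_quadD hyp_quadZ !hyp_quad_bas dotZr dot_bas negK co_bas eqxx.
by rewrite mulr0 !add0r mulr1 => ->; rewrite scale0r addr0.
Qed.

(** Each further nonzero coordinate b of smaller absolute value is
    cancelled by Gx c b, which changes only the coordinates at b and at
    neg c. The coordinate at neg c disappears at the end because the
    vector is singular. All the factors fix e_(neg c), so the lemma can be
    applied to e_c and then to its partner. *)
Lemma clear_row (c : sidx n) v : supp c.1 v -> hyp_quad v = 0 -> co v c = 1 ->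
  exists h, [/\ low c.1 h, v *m val h = bas c & bas (neg c) *m val h = bas (neg c)].
Proof.
move: {2}_.+1 (ltnSn #|[set b | (b.1 != c.1) && (co v b == 1)]|) => m.
elim: m v => // m IH v lt_m sv Qv vc.
have [b /andP[bc vb]|none] := pickP (fun b : sidx n => (b.1 != c.1) && (co v b == 1)); last first.
  exists 1%g; rewrite GO_val1 !mulmx1; split => //.
    by split => // a; rewrite mulmx1.
  apply: singular_support => // a ac; have := none a; rewrite ac /= => va.
  by rewrite [co v a]F2_eq va.
have cb : c.1 != b.1 by rewrite eq_sym.
have bk : (b.1 <= c.1)%N.
  by rewrite leqNgt; apply/negP => kb; move: vb; rewrite sv // => /eqP.
have Lx : low c.1 (Gx c b) by apply: low_Gx.
have vx a : a.1 != c.1 -> co (v *m val (Gx c b)) a = co v a + (a == b)%:R.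
  move=> ac; rewrite mul_Gx // !(coD, coZ, co_bas) vc mul1r.
  by rewrite (sidx_neqF ac) mulr0 addr0.
(* One coordinate fewer is left to clear. *)
have [||||h [Lh vh ch]] := IH (v *m val (Gx c b)).
- rewrite ltnS in lt_m; apply: leq_trans lt_m; apply: proper_card.
  apply/properP; split; last exists b.
  + apply/fintype.subsetP => a; rewrite !inE; have [//|ac /=] := eqVneq a.1 c.1.
    rewrite vx //; have [->|_] := eqVneq a b; last by rewrite addr0.
    by rewrite (eqP vb).
  + by rewrite inE bc.
  + by rewrite inE bc vx // (eqP vb) eqxx F2_addxx.
- by apply: low_supp => //; case: Lx.
- by rewrite GO_quad.
- by rewrite mul_Gx // !(coD, coZ, co_bas) vc !(sidx_neqF cb, neg_eqF) !mulr0 !addr0.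
exists (Gx c b * h)%g; split; first exact: lowM.
  by rewrite GO_valM mulmxA.
rewrite GO_valM mulmxA mul_Gx // !co_bas !(sidx_neqF cb, neg_eqF).
by rewrite !scale0r !addr0.
Qed.

Lemma reach_aux (c a : sidx n) v : (a.1 < c.1)%N -> co v a = 1 ->
  exists2 h, low c.1 h & co (v *m val h) c = 1.
Proof.
move=> ac va; have ac' : a.1 != c.1 by apply/eqP => E; move: ac; rewrite E ltnn.
have [vc|vc] := eqVneq (co v c) 1.
  by exists 1%g; rewrite ?mulmx1 //; split => // b; rewrite mulmx1.
exists (Gx a c); first by apply: low_Gx => //; apply: ltnW.
rewrite mul_Gx // !(coD, coZ, co_bas) va eqxx (sidx_neqF ac') mulr0 addr0.
by rewrite (F2_neq1 vc) add0r mulr1.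
Qed.

(** A nonzero coordinate of smaller absolute value is copied to c by one
    root element; if only the coordinate at neg c is nonzero, a first root
    element spreads it to the index 0. *)
Lemma reach (c : sidx n) v : (0 < c.1)%N -> supp c.1 v -> v != 0 ->
  exists2 h, low c.1 h & co (v *m val h) c = 1.
Proof.
move=> c0 sv v0.
have [vc|vc] := eqVneq (co v c) 1.
  by exists 1%g; rewrite ?mulmx1 //; split => // b; rewrite mulmx1.
have [a va] : exists a, co v a = 1.
  apply: contrapT => none; move/eqP: v0; apply; apply: co_inj => a.
  rewrite co0 [co v a]F2_eq; case: eqP => // E; case: none; by exists a.
case: (ltngtP (a.1 : nat) c.1) => [ac|ca|ac].
- exact: reach_aux ac va.
- by move: va; rewrite sv // => /eqP.
have /sidx_cases[E|E] : a.1 = c.1 by apply: val_inj.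
  by move: vc; rewrite -E va eqxx.
have i0P : (0 < n)%N by apply: leq_ltn_trans (ltn_ord c.1).
pose b : sidx n := (Ordinal i0P, false).
have [vb|vb] := eqVneq (co v b) 1; first exact: reach_aux vb.
have ab : a.1 != b.1 by apply/eqP => F; move: c0; rewrite -ac F.
have [|h Lh hc] := @reach_aux c b (v *m val (Gx a b)) c0.
  rewrite mul_Gx // !(coD, coZ, co_bas) va eqxx.
  have ba : b.1 != a.1 by rewrite eq_sym.
  rewrite (sidx_neqF ba) mulr0 addr0.
  by rewrite (F2_neq1 vb) add0r mulr1.
exists (Gx a b * h)%g; last by rewrite GO_valM mulmxA.
by apply: lowM => //; apply: low_Gx => //; rewrite ?ac //; apply: ltnW.
Qed.

Lemma GO_neq0 g v : v != 0 -> v *m val g != 0.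
Proof.
apply: contra => /eqP vg; rewrite -[v]mulmx1 -GO_val1 -(mulgV g) GO_valM mulmxA vg.
by rewrite mul0mx.
Qed.

Lemma bas_neq0 a : bas a != 0.
Proof. by apply/eqP => /(congr1 (fun v => co v a)); rewrite co_bas co0 eqxx => /eqP. Qed.

Hypothesis n0 : (0 < n)%N.
Let o : 'I_n := Ordinal n0.
Let t0 := Gt (bas (o, false) + bas (o, true)).

Lemma t0_quad : hyp_quad (bas (o, false) + bas (o, true)) = 1.
Proof. by rewrite hyp_quadD !hyp_quad_bas dot_bas co_bas eqxx !add0r. Qed.

Lemma bas_supp a : supp a.1 (bas a).
Proof.
move=> b ab; rewrite co_bas; case: eqP => // E; by move: ab; rewrite E ltnn.
Qed.

(** Induction on the number of rows still to be treated. Root elements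
    bring the image of e_k back to e_k, then the image of f_k back to f_k
    while fixing e_k; what remains acts on the hyperbolic planes of
    smaller index. On the last plane the only isometries are the identity
    and the swap t0 of e_0 and f_0. *)
Lemma elimination k g : (forall a, (k < a.1)%N -> bas a *m val g = bas a) ->
  S g \/ S (t0 * g)%g.
Proof.
elim: k g => [|k IH] g Fg.
  have s0 e : forall a, a.1 != o -> co (bas (o, e) *m val g) a = 0.
    move=> a ao; apply: (low_supp Fg (@bas_supp (o, e))).
    by rewrite lt0n.
  have [e ve] : exists e, co (bas (o, false) *m val g) (o, e) = 1.
    apply: contrapT => none; have := GO_neq0 g (bas_neq0 (o, false)) => /eqP; apply.
    apply: co_inj => a; rewrite co0; have [ao|] := eqVneq a.1 o; last exact: s0.
    rewrite [co _ a]F2_eq; case: eqP => // E; case: none; exists a.2.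
    by move: E; rewrite -ao; case: (a).
  have Ef : bas (o, false) *m val g = bas (o, e).
    by apply: singular_support => //; [apply: s0 | rewrite GO_quad hyp_quad_bas].
  have Et : bas (o, true) *m val g = bas (o, ~~ e).
    apply: singular_support => //; [exact: s0 | by rewrite GO_quad hyp_quad_bas |].
    rewrite -[(o, ~~ e)]/(neg (o, e)) -dot_bas -Ef GO_dot dot_bas co_bas.
    by rewrite eqxx.
  have Fg' a : a.1 != o -> bas a *m val g = bas a.
    by move=> ao; apply: Fg; rewrite lt0n.
  case: e ve Ef Et => _ Ef Et.
    right; suff -> : (t0 * g)%g = 1%g by [].
    apply: GO_inj => a; rewrite GO_valM mulmxA mulmx1 mul_Gt ?t0_quad //.
    rewrite dotDr !dot_bas !co_bas mulmxDl -scalemxAl mulmxDl Ef Et.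
    have [ao|ao] := eqVneq a.1 o; last first.
      have oa : (o, false).1 != a.1 by rewrite eq_sym.
      have oa' : (o, true).1 != a.1 by rewrite eq_sym.
      by rewrite !(sidx_neqF oa, sidx_neqF oa') addr0 scale0r addr0 Fg'.
    case: a ao => i [] /= ->; rewrite ?Ef ?Et !xpair_eqE !eqxx /= ?addr0 ?add0r scale1r.
      by rewrite addrC -addrA F2_addvv addr0.
    by rewrite addrA F2_addvv add0r.
  left; suff -> : g = 1%g by [].
  apply: GO_inj => a; rewrite mulmx1.
  have [ao|ao] := eqVneq a.1 o; last exact: Fg'.
  by case: a ao => i [] /= ->.
have [kn|kn] := ltnP k.+1 n; last first.
  by apply: IH => a ka; have := ltn_ord a.1; lia.
pose c : sidx n := (Ordinal kn, false).
have [h1 [L1 E1]] : exists h, low k.+1 h /\ bas c *m val (g * h)%g = bas c.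
  have [h Lh hc] := @reach c (bas c *m val g) isT (low_supp Fg (@bas_supp c)) (GO_neq0 g (bas_neq0 c)).
  have Q0 : hyp_quad (bas c *m val g *m val h) = 0 by rewrite !GO_quad hyp_quad_bas.
  have [h' [Lh' E _]] := @clear_row c _ (low_supp Lh.2 (low_supp Fg (@bas_supp c))) Q0 hc.
  by exists (h * h')%g; split; [apply: lowM | rewrite !GO_valM !mulmxA].
have Fg1 a : (k.+1 < a.1)%N -> bas a *m val (g * h1)%g = bas a.
  by move=> ka; rewrite GO_valM mulmxA Fg // L1.2.
have [||h2 [L2 E2 E3]] := @clear_row (neg c) (bas (neg c) *m val (g * h1)%g) (low_supp Fg1 (@bas_supp (neg c))).
- by rewrite GO_quad hyp_quad_bas.
- by rewrite -dot_bas -E1 GO_dot dot_bas co_bas eqxx.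
have Sh : S (h1 * h2)%g by apply: SM; [case: L1 | case: L2].
have := IH (g * h1 * h2)%g; case=> [a ka|Sg|Sg].
- have [ac|ac] := eqVneq a.1 c.1; last first.
    have ka' : (k.+1 < a.1)%N by rewrite ltn_neqAle ka andbT eq_sym.
    by rewrite GO_valM mulmxA Fg1 ?L2.2.
  by case: (sidx_cases ac) => ->; rewrite GO_valM mulmxA // E1 -[c]negK.
- by left; rewrite -(mulgK (h1 * h2)%g g); apply: SM; [rewrite mulgA | apply: SV].
by right; rewrite -(mulgK (h1 * h2)%g (t0 * g)%g); apply: SM; [rewrite !mulgA in Sg *| apply: SV].
Qed.

Lemma elimination_all g : S g \/ S (t0 * g)%g.
Proof. by apply: (@elimination n) => a; have := ltn_ord a.1; lia. Qed.

End Elimination.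

Local Open Scope group_scope.

(** * The Weyl group inside the presented group *)

Section Flips.
Variable n : nat.
Local Open Scope ring_scope.

(** The reflection that exchanges e_i and f_i; Z acts as Gz i0 i1. *)
Definition Gf (i : 'I_n) := Gt (bas (i, false) + bas (i, true)).
Definition Gz : 'I_n -> 'I_n -> GO_plus n := locked (fun i j => Gf i * Gf j)%g.

Lemma flip_quad (i : 'I_n) : hyp_quad (bas (i, false) + bas (i, true)) = 1.
Proof. by rewrite hyp_quadD !hyp_quad_bas dot_bas co_bas eqxx !add0r. Qed.

Lemma bas_Gf (i k : 'I_n) e : bas (k, e) *m val (Gf i) = bas (k, e (+) (k == i)).
Proof.
rewrite mul_Gt ?flip_quad // dotDr !dot_bas !co_bas !xpair_eqE /= ![i == k]eq_sym.
have [->|_] := eqVneq k i; last by rewrite addr0 scale0r addr0 addbF.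
rewrite /= addbT; case: e; rewrite /= ?addr0 ?add0r scale1r.
  by rewrite addrC -addrA F2_addvv addr0.
by rewrite addrA F2_addvv add0r.
Qed.

Lemma bas_Gz (i j k : 'I_n) e :
  bas (k, e) *m val (Gz i j) = bas (k, e (+) (k == i) (+) (k == j)).
Proof. by rewrite /Gz -lock GO_valM mulmxA !bas_Gf. Qed.

Lemma GzJ (i j : 'I_n) s : (Gz i j ^ Gs s = Gz (s i) (s j))%g.
Proof.
apply: GO_conjP => v; rewrite [v]row_bas !mulmx_suml; apply: eq_bigr => -[k e] _.
by rewrite -!scalemxAl bas_Gz !bas_Gs bas_Gz /= !(inj_eq perm_inj).
Qed.
End Flips.

Lemma sym_V_succ n (i j : 'I_n) : j = i.+1 :> nat -> sym_V n i = j.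
Proof.
move=> ji; apply: val_inj; rewrite permE /= modn_small ?ji //.
by rewrite -ji.
Qed.

Section SymmetricGenerators.
Variables (n : nat) (hn : (2 < n)%N).

Definition i0 : 'I_n := Ordinal (ltnW (ltnW hn)).
Definition i1 : 'I_n := Ordinal (ltnW hn).
Definition i2 : 'I_n := Ordinal hn.

Local Notation sU := (sym_U hn).
Local Notation sV := (sym_V n).

Lemma sV0 : sV i0 = i1. Proof. exact: sym_V_succ. Qed.
Lemma sV1 : sV i1 = i2. Proof. exact: sym_V_succ. Qed.
Lemma sU0 : sU i0 = i1. Proof. exact: tpermL. Qed.
Lemma sU1 : sU i1 = i0. Proof. exact: tpermR. Qed.
Lemma sU_big (i : 'I_n) : (1 < i)%N -> sU i = i.
Proof. by move=> hi; apply: tpermD; apply/eqP => /(congr1 val) /=; lia. Qed.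
Lemma sU2 : sU i2 = i2. Proof. exact: sU_big. Qed.
Lemma sUV : sU ^ sV = tperm i1 i2. Proof. by rewrite tpermJ -/i0 -/i1 sV0 sV1. Qed.
Lemma sUVU : sU ^ (sV * sU) = tperm i0 i2.
Proof. by rewrite tpermJ !permM -/i0 -/i1 sV0 sV1 sU1 sU2. Qed.

Definition tail_cycle := sV * sU * sU ^ sV.

Lemma tail_cycle_succ (i j : 'I_n) : (1 < i)%N -> j = i.+1 :> nat -> tail_cycle i = j.
Proof.
move=> hi ji; have j1 : (1 < j)%N by rewrite ji ltnW.
rewrite /tail_cycle sUV !permM (sym_V_succ ji) sU_big //.
by rewrite tpermD //; apply/eqP => /(congr1 val) /=; lia.
Qed.

(** U^(V^2) is the transposition of the points 2 and 3, and V U U^V is the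
    cycle through the points from 2 on; together they generate the
    stabiliser of the points 0 and 1. *)
Lemma commute_tail (G : groupType) (rho : UMagmaMorphism.type {perm 'I_n} G) X :
    ((3 < n)%N -> commute X (rho (sU ^ (sV ^+ 2)))) ->
    ((4 < n)%N -> commute X (rho tail_cycle)) ->
  forall s : {perm 'I_n}, s i0 = i0 -> s i1 = i1 -> commute X (rho s).
Proof.
move=> h3 h4 s s0 s1.
apply: (@sym_tail_ind _ (fun s => commute X (rho s)) 2) => [|{s0 s1}s t Cs Ct||i].
- by rewrite gmulf1; apply: commute1.
- by rewrite gmulfM; apply: commuteM.
- move=> i j; move: {2}(nat_of_ord i) (erefl (nat_of_ord i)) => m.
  elim: m i j => [|m IH] i j im i_ge ji; first by rewrite im in i_ge.
  have lt_j := ltn_ord j.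
  have [i2E|i_gt] := eqVneq (nat_of_ord i) 2.
    have n3 : (3 < n)%N by lia.
    have -> : tperm i j = sU ^ (sV ^+ 2); last exact: h3.
    have Ei : i = i2 by apply: val_inj.
    rewrite tpermJ -/i0 -/i1 expg2 !permM sV0 sV1 (@sym_V_succ _ i2 j) ?Ei //.
    by rewrite -Ei.
  have lt_k : (i.-1 < n)%N by lia.
  pose k := Ordinal lt_k.
  have -> : tperm i j = tperm k i ^ tail_cycle.
    by rewrite tpermJ (@tail_cycle_succ k i) ?(@tail_cycle_succ i j) //=; lia.
  rewrite gmulfJ conjgE.
  have n4 : (4 < n)%N by lia.
  apply: commuteM; first by apply: commuteV; apply: h4.
  by apply: commuteM; [apply: IH => //=; lia | apply: h4].
- case: i => [[|[|//]] lt_i] _.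
    by have -> : Ordinal lt_i = i0 by apply: val_inj.
  by have -> : Ordinal lt_i = i1 by apply: val_inj.
Qed.

End SymmetricGenerators.

(** This identity and the next one are the two cases of the multiplication
    rule B w B s for double cosets: X is the element of a simple root
    subgroup, s its reflection, and y the conjugate of X by the inverse of
    w, or by that of w s. *)
Lemma cell_calc1 (G : groupType) (u w s X h y k : G) :
  h * s = s * k -> w * X = y * w -> u * w * (X * h) * s = u * y * (w * s) * k.
Proof. by move=> hs wX; rewrite -!mulgA hs (mulgA w X) wX -!mulgA. Qed.

Lemma cell_calc2 (G : groupType) (u w s X h y k : G) :
    h * s = s * k -> s * s = 1 -> s * X * s = X * s * X -> w * s * X = y * (w * s) ->
  u * w * (X * h) * s = u * y * w * (X * k).
Proof.
move=> hs ss sX wX; have E : w * X * s = y * w * X.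
  transitivity (w * s * X * (s * X)).
    by rewrite -!mulgA (mulgA X) -sX -!mulgA (mulgA s s) ss mul1g.
  by rewrite wX -!mulgA (mulgA s s) ss mul1g.
by rewrite -!mulgA hs (mulgA w X) (mulgA (w * X)) E -!mulgA.
Qed.

Section Presented.
Variables (n : nat) (hn : (2 < n)%N) (G : groupType).
Variable rho : UMagmaMorphism.type {perm 'I_n} G.
Variable phi : UMagmaMorphism.type G (GO_plus n).
Variables sigma Z : G.

Implicit Types (s t : {perm 'I_n}) (i j k l : 'I_n) (a b c d : sidx n) (w g : G).

Local Notation sU := (sym_U hn).
Local Notation sV := (sym_V n).
Local Notation i0 := (i0 hn).
Local Notation i1 := (i1 hn).
Local Notation i2 := (i2 hn).
Local Notation U := (rho sU).
Local Notation V := (rho sV).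

Hypothesis rels : forall r, r \in relators n sigma Z U V -> r = 1.
Hypothesis phi_rho : forall s, phi (rho s) = Gs s.
Hypothesis phi_Z : phi Z = Gz i0 i1.

Ltac in_relators := apply: rels; rewrite /relators !mem_cat !inE ?eqxx ?orbT.

Lemma Z_commU : commute Z U.
Proof. by apply/commgP/eqP; in_relators. Qed.

Lemma Z_tail s : s i0 = i0 -> s i1 = i1 -> commute Z (rho s).
Proof.
apply: commute_tail => h.
  rewrite gmulfJ gmulfXn; apply/commgP/eqP; apply: rels.
  by rewrite /relators h !mem_cat !inE eqxx.
rewrite 2!gmulfM gmulfJ; apply/commgP/eqP; apply: rels.
by rewrite /relators h !mem_cat !inE eqxx !orbT.
Qed.

Lemma conj_rho X s t : (forall r : {perm 'I_n}, r i0 = i0 -> r i1 = i1 -> commute X (rho r)) ->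
  s i0 = t i0 -> s i1 = t i1 -> X ^ rho s = X ^ rho t.
Proof.
move=> Xr s0 s1; rewrite -{1}[s](mulgVK t) gmulfM conjgM (conjg_commute (Xr (s * t^-1) _ _)) //.
  by rewrite permM s0 permK.
by rewrite permM s1 permK.
Qed.

Definition zperm i j : {perm 'I_n} := tperm i0 i * tperm (tperm i0 i i1) j.

Lemma zperm0 i j : i != j -> zperm i j i0 = i.
Proof.
move=> ij; rewrite permM tpermL; apply: tpermD; last by rewrite eq_sym.
apply/eqP => E; have : tperm i0 i i1 = tperm i0 i i0 by rewrite E tpermL.
by move/perm_inj/(congr1 val).
Qed.
Lemma zperm1 i j : zperm i j i1 = j.
Proof. by rewrite permM tpermL. Qed.

(** The sign change at i and j, as a conjugate of Z. The choice of the
    conjugating permutation is irrelevant by zE, because Z commutes with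
    the stabiliser of the points 0 and 1. *)
Definition z i j : G := if i == j then 1 else Z ^ rho (zperm i j).

Lemma zE s : z (s i0) (s i1) = Z ^ rho s.
Proof.
rewrite /z (inj_eq perm_inj) /=; apply: conj_rho; first exact: Z_tail.
  by rewrite zperm0 // (inj_eq perm_inj).
by rewrite zperm1.
Qed.

Lemma zii i : z i i = 1. Proof. by rewrite /z eqxx. Qed.

Lemma z01 : z i0 i1 = Z.
Proof. by have := zE 1; rewrite !perm1 gmulf1 conjg1. Qed.

Lemma zJ i j s : z i j ^ rho s = z (s i) (s j).
Proof.
have [->|ij] := eqVneq i j; first by rewrite !zii conj1g.
have := zE (zperm i j * s).
by rewrite !(permM (zperm i j) s) zperm0 // zperm1 gmulfM conjgM -zE zperm0 // zperm1 => ->.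
Qed.

Lemma z_std s i j k l : z i j = z k l -> z (s i) (s j) = z (s k) (s l).
Proof. by move=> E; rewrite -!zJ E. Qed.

Lemma zC i j : z i j = z j i.
Proof.
have [->//|ij] := eqVneq i j.
have Z10 : z i1 i0 = z i0 i1.
  by have := zE sU; rewrite sU0 sU1 z01 => ->; apply: conjg_commute; apply: Z_commU.
have [||//|s [<- <-]] := @perm_of_uniq_seqs _ [:: i0; i1] [:: i; j] => //.
  by rewrite /= inE ij.
exact/esym/z_std.
Qed.

Lemma zK i j : z i j * z i j = 1.
Proof.
have [->|ij] := eqVneq i j; first by rewrite zii mulg1.
rewrite -(zperm0 ij) -{2 4}(zperm1 i j) zE -conjMg.
have -> : Z * Z = 1 by apply: rels; rewrite -expg2 /relators !mem_cat !inE eqxx !orbT.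
exact: conj1g.
Qed.

Lemma Z_V : Z ^ V = z i1 i2. Proof. by rewrite -z01 zJ sV0 sV1. Qed.

(** The relation Z Z^V = Z^(U^V) moved to arbitrary indices. It shows that
    all sign changes are products of the commuting elements z i0 i. *)
Lemma zM i j k : z i j * z j k = z i k.
Proof.
have [->|ij] := eqVneq i j; first by rewrite zii mul1g.
have [->|jk] := eqVneq j k; first by rewrite zii mulg1.
have [->|ik] := eqVneq i k; first by rewrite zC zii zK.
have [||//|s [<- <- <-]] := @perm_of_uniq_seqs _ [:: i0; i1; i2] [:: i; j; k] => //.
  by rewrite /= !inE negb_or ij ik jk.
rewrite -!zJ -conjMg; congr (_ ^ _).
have : Z * Z ^ V * (Z ^ (U ^ V))^-1 = 1 by in_relators.
move/divg1_eq; rewrite z01 Z_V => ->.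
by rewrite -gmulfJ sUV -z01 zJ tpermL tpermD.
Qed.

Lemma z_comm k i j : commute (z k i) (z k j).
Proof.
have [->|ki] := eqVneq k i; first by rewrite zii; apply/commute_sym/commute1.
have [->|kj] := eqVneq k j; first by rewrite zii; apply: commute1.
have [->|ij] := eqVneq i j; first exact: commute_refl.
have [||//|s [<- <- <-]] := @perm_of_uniq_seqs _ [:: i1; i0; i2] [:: k; i; j] => //.
  by rewrite /= !inE negb_or ki kj ij.
rewrite -!zJ; apply: commuteJ; rewrite zC z01 -Z_V.
by apply/commgP/eqP; in_relators.
Qed.

Definition zprod k (L : seq 'I_n) : G := iprod (z k) L.

Lemma zprodJ k L s : zprod k L ^ rho s = zprod (s k) (map s L).
Proof. by rewrite /zprod /iprod conjg_prod big_map; apply: eq_bigr => i _; rewrite zJ. Qed.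

(** By zM, z k i = z i0 k * z i0 i. *)
Lemma zprod_base k L : exists L', zprod k L = zprod i0 L'.
Proof.
elim: L => [|i L [L' E]]; first by exists [::]; rewrite /zprod !iprod_nil.
exists [:: k, i & L']; rewrite /zprod !iprod_cons mulgA.
by rewrite -/(zprod k L) E [z i0 k]zC zM.
Qed.

Lemma zprod_cat k L1 L2 : zprod k L1 * zprod k L2 = zprod k (L1 ++ L2).
Proof. by rewrite /zprod iprod_cat. Qed.

Lemma zprodK k L : zprod k L * zprod k L = 1.
Proof.
by apply: (@iprodK _ _ _ predT) => [a _|a b _ _|]; [exact: zK | exact: z_comm | apply/allP].
Qed.

Lemma zprod_uniq L : exists L', [/\ uniq L', i0 \notin L' & zprod i0 L = zprod i0 L'].
Proof.
have [L' [u' _ E]] := @iprod_uniq _ _ (z i0) predT (fun i _ => zK i0 i)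
  (fun i j _ _ => z_comm i0 i j) L (introT allP (fun i _ => isT)).
rewrite /zprod E => {E}.
have [iL|iL] := boolP (i0 \in L'); last by exists L'.
exists (rem i0 L'); split; first exact: rem_uniq.
  by rewrite mem_rem_uniq // !inE eqxx.
rewrite (@iprod_rem _ _ _ predT (fun i j _ _ => z_comm i0 i j) i0) ?zii ?mul1g //.
exact/allP.
Qed.

(** Normal form of the elements of the subgroup generated by Z and the
    symmetric group: an even sign change followed by a permutation. *)
Definition W w := exists L s, w = zprod i0 L * rho s.

Lemma W_zprod k L : W (zprod k L).
Proof. by have [L' ->] := zprod_base k L; exists L', 1; rewrite gmulf1 mulg1. Qed.

Lemma W_rho s : W (rho s).
Proof. by exists [::], s; rewrite /zprod iprod_nil mul1g. Qed.

Lemma W1 : W 1. Proof. by have := W_rho 1; rewrite gmulf1. Qed.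

Lemma W_z i j : W (z i j).
Proof. by have := W_zprod i [:: j]; rewrite /zprod iprod_cons iprod_nil mulg1. Qed.

Lemma W_Z : W Z. Proof. by rewrite -z01; apply: W_z. Qed.

Lemma W_M w1 w2 : W w1 -> W w2 -> W (w1 * w2).
Proof.
move=> [L1 [s1 ->]] [L2 [s2 ->]].
have [L3 E3] := zprod_base (s1^-1 i0) (map s1^-1 L2).
exists (L1 ++ L3), (s1 * s2); rewrite -zprod_cat -E3 -zprodJ gmulfM gmulfV.
by rewrite conjgE invgK !mulgA mulgVK.
Qed.

Lemma W_V w : W w -> W w^-1.
Proof.
move=> [L [s ->]]; rewrite invgM -gmulfV; apply: W_M; first exact: W_rho.
have -> : (zprod i0 L)^-1 = zprod i0 L by apply/eqP; rewrite eq_sym -mulg_eq1 zprodK.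
exact: W_zprod.
Qed.

(** The signed permutation induced by an element of W, read off from its
    matrix. *)
Definition act w a : sidx n :=
  if [pick b | bas a *m val (phi w) == bas b] is Some b then b else a.

Lemma actE w a b : bas a *m val (phi w) = bas b -> act w a = b.
Proof.
move=> E; rewrite /act; case: pickP => [c /eqP|/(_ b)]; rewrite E ?eqxx //.
by move/bas_inj.
Qed.

Lemma act_rho s a : act (rho s) a = (s a.1, a.2).
Proof. by apply: actE; rewrite phi_rho bas_Gs. Qed.

Lemma phi_z i j : i != j -> phi (z i j) = Gz i j.
Proof.
move=> ij; have -> : z i j = Z ^ rho (zperm i j) by rewrite -zE zperm0 // zperm1.
by rewrite gmulfJ phi_rho phi_Z GzJ zperm0 // zperm1.
Qed.

(** Base point k is flipped once by each factor z k i, and twice, that is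
    not at all, by z k k = 1; this is why the formula also holds for lists
    that contain k. *)
Definition flip k (L : seq 'I_n) i := odd (count_mem i L) (+) ((i == k) && odd (size L)).

Lemma bas_zprod k L a :
  bas a *m val (phi (zprod k L)) = bas (a.1, a.2 (+) flip k L a.1).
Proof.
elim: L a => [|j L IH] [i e] /=.
  by rewrite /zprod iprod_nil gmulf1 mulmx1 /flip /= andbF !addbF.
rewrite /zprod iprod_cons gmulfM GO_valM mulmxA.
have -> : bas (i, e) *m val (phi (z k j)) = bas (i, e (+) (i == k) (+) (i == j)).
  have [<-|kj] := eqVneq k j; last by rewrite phi_z // bas_Gz.
  by rewrite zii gmulf1 mulmx1 -addbA addbb addbF.
rewrite IH; congr (bas (_, _)); rewrite /flip /= oddD oddb [j == i]eq_sym.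
by case: (i == k); case: (i == j); case: (odd _); case: (odd _); case: e.
Qed.

Lemma act_zprod k L a : act (zprod k L) a = (a.1, a.2 (+) flip k L a.1).
Proof. exact/actE/bas_zprod. Qed.

Lemma bas_act w a : W w -> bas a *m val (phi w) = bas (act w a).
Proof.
move=> [L [s ->]]; set b : sidx n := (s a.1, a.2 (+) flip i0 L a.1).
have E : bas a *m val (phi (zprod i0 L * rho s)) = bas b.
  by rewrite gmulfM GO_valM mulmxA bas_zprod phi_rho bas_Gs.
by rewrite (actE E).
Qed.

Lemma act_M w1 w2 a : W w1 -> W w2 -> act (w1 * w2) a = act w2 (act w1 a).
Proof.
by move=> W1 W2; apply: actE; rewrite gmulfM GO_valM mulmxA !bas_act.
Qed.

Lemma act1 a : act 1 a = a.
Proof. by apply: actE; rewrite gmulf1 mulmx1. Qed.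

Lemma act_form w : W w -> exists s f, forall a, act w a = (s a.1, a.2 (+) f a.1).
Proof.
move=> [L [s ->]]; exists s, (flip i0 L) => a.
by rewrite act_M ?act_rho ?act_zprod //; [apply: W_zprod | apply: W_rho].
Qed.

Lemma act_neg w a : W w -> act w (neg a) = neg (act w a).
Proof. by move=> /act_form[s [f E]]; rewrite !E /neg /= addNb. Qed.

Lemma act_abs w a b : W w -> ((act w a).1 == (act w b).1) = (a.1 == b.1).
Proof. by move=> /act_form[s [f E]]; rewrite !E /= (inj_eq perm_inj). Qed.

Lemma actK w a : W w -> act w^-1 (act w a) = a.
Proof. by move=> Ww; rewrite -act_M ?mulgV ?act1 //; apply: W_V. Qed.

Lemma actKV w a : W w -> act w (act w^-1 a) = a.
Proof. by move=> Ww; rewrite -act_M ?mulVg ?act1 //; apply: W_V. Qed.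

(** In square-free normal form the list of sign changes and the
    permutation can both be recovered from the action. Hence phi maps W
    isomorphically onto the Weyl group of type D_n. *)
Lemma act_faithful w : W w -> (forall a, act w a = a) -> w = 1.
Proof.
move=> [L [s ->]]; have [L' [uL' i0L' ->]] := zprod_uniq L => E.
have {}E a : (s a.1, a.2 (+) flip i0 L' a.1) = a.
  by rewrite -[RHS]E act_M ?act_rho ?act_zprod //; [apply: W_zprod | apply: W_rho].
have s1 : s = 1 by apply/permP => i; have [-> _] := E (i, false); rewrite perm1.
have L0 i : i \notin L'.
  have [->//|ii0] := eqVneq i i0.
  have [_] := E (i, false); rewrite /flip /= (negPf ii0) addbF count_uniq_mem //.
  by case: (i \in L').
have -> : L' = [::] by case: (L') L0 => // i l /(_ i); rewrite inE eqxx.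
by rewrite s1 gmulf1 mulg1 /zprod iprod_nil.
Qed.

Lemma W_inj w1 w2 : W w1 -> W w2 -> act w1 =1 act w2 -> w1 = w2.
Proof.
move=> W1 W2 E; apply/divg1_eq/act_faithful; first exact: W_M (W_V W2).
by move=> a; rewrite act_M ?E ?actK //; apply: W_V.
Qed.

(** An element of W changes an even number of signs, so the signs can be
    prescribed at all indices except one, which absorbs the parity. *)
Lemma W_transitive s (f : 'I_n -> bool) k : exists w, [/\ W w,
  forall i e, i != k -> act w (i, e) = (s i, e (+) f i) &
  forall e, (act w (k, e)).1 = s k].
Proof.
pose L := fintype.enum [pred i | f i].
exists (zprod k L * rho s).
have Wz := W_zprod k L; have Ws := W_rho s.
split; first exact: W_M.
  move=> i e ik; rewrite act_M // act_rho act_zprod /=.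
  rewrite /flip (negPf ik) addbF count_uniq_mem ?enum_uniq //.
  by rewrite mem_enum inE; case: (f i).
by move=> e; rewrite act_M // act_rho act_zprod.
Qed.

(** * Root elements of the presented group and their commutators *)

Hypothesis sigmaK : sigma * sigma = 1.
Hypothesis sigma_braid : U * sigma * U = sigma * U * sigma.
Local Notation o0 := ((i0, false) : sidx n).
Local Notation o1 := ((i1, false) : sidx n).
Local Notation o2 := ((i2, false) : sidx n).
Hypothesis phi_sigma : phi sigma = Gx o0 o1.

Lemma sigma_tail s : s i0 = i0 -> s i1 = i1 -> commute sigma (rho s).
Proof.
apply: commute_tail => h.
  rewrite gmulfJ gmulfXn; apply/commgP/eqP; apply: rels.
  by rewrite /relators h !mem_cat !inE eqxx !orbT.
rewrite 2!gmulfM gmulfJ; apply/commgP/eqP; apply: rels.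
by rewrite /relators h !mem_cat !inE eqxx !orbT.
Qed.

Lemma two_more i j : i != j -> i != i0 -> i != i1 -> j != i0 -> j != i1 -> (3 < n)%N.
Proof.
move=> ij a b c d; have u : uniq [:: i; j; i0; i1].
  by rewrite /= !inE !negb_or ij a b c d.
by have := max_card (mem [:: i; j; i0; i1]); rewrite (card_uniqP u) card_ord.
Qed.

Lemma sigma_z i j : i != i0 -> i != i1 -> j != i0 -> j != i1 -> commute sigma (z i j).
Proof.
move=> ii0 ii1 ji0 ji1.
have [->|ij] := eqVneq i j; first by rewrite zii; apply: commute1.
have h3 := two_more ij ii0 ii1 ji0 ji1; pose i3 : 'I_n := Ordinal h3.
have u1 : uniq [:: i0; i1; i2; i3] by [].
have u2 : uniq [:: i0; i1; i; j].
  by rewrite /= !inE !negb_or ij ![_ == i]eq_sym ![_ == j]eq_sym ii0 ii1 ji0 ji1.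
have [//|s [s0 s1 <- <-]] := perm_of_uniq_seqs u1 u2.
have V2 : Z ^ (V ^+ 2) = z i2 i3.
  rewrite -z01 -gmulfXn zJ expg2 !permM sV0 sV1.
  by rewrite (@sym_V_succ _ i2 i3).
rewrite -zJ -(conjg_commute (sigma_tail s0 s1)); apply: commuteJ; rewrite -V2.
apply/commgP/eqP; apply: rels.
by rewrite /relators h3 !mem_cat !inE eqxx !orbT.
Qed.

(** The factors are taken in pairs: z i0 i * z i0 j = z i j, a conjugate
    of Z^(V^2) under the stabiliser of 0 and 1. *)
Lemma sigma_zprod L : i1 \notin L -> i0 \notin L -> ~~ odd (size L) ->
  commute sigma (zprod i0 L).
Proof.
move: {2}_.+1 (ltnSn (size L)) => m; elim: m L => // m IH [|i [|j L]] //= lt_m.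
  by move=> *; rewrite /zprod iprod_nil; apply: commute1.
rewrite !inE !negb_or => /and3P[i1i i1j i1L] /and3P[i0i i0j i0L] oL.
rewrite /zprod !iprod_cons mulgA [z i0 i]zC zM; apply: commuteM.
  by apply: sigma_z; rewrite eq_sym.
by apply: IH => //; [exact: ltnW | move: oL; rewrite negbK].
Qed.

(** The normal form of w consists of an even sign change and a
    permutation, both away from the indices 0 and 1. *)
Lemma sigma_stab w : W w -> act w o0 = o0 -> act w o1 = o1 -> sigma ^ w = sigma.
Proof.
move=> [L [s ->]]; have [L' [uL' i0L' ->]] := zprod_uniq L.
rewrite !act_M ?act_rho ?act_zprod /=; [|exact: W_zprod|exact: W_rho|exact: W_zprod|exact: W_rho].
case=> s0 f0 [s1 f1].
have oL : ~~ odd (size L').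
  by move: f0; rewrite /flip eqxx count_uniq_mem // (negPf i0L') /= => ->.
have i1L : i1 \notin L'.
  by move: f1; rewrite /flip count_uniq_mem //; case: (i1 \in L').
apply: conjg_commute; apply: commuteM; first exact: sigma_zprod.
exact: sigma_tail.
Qed.

(** The conjugates of sigma under W, labelled by the pair of signed
    indices to which (0, 1) is carried. By sigma_stab the label determines
    the conjugate, whichever w is chosen. *)
Definition xroot a b : G :=
  sigma ^ xget 1 [set w | [/\ W w, act w o0 = a & act w o1 = b]].

Lemma xE w : W w -> xroot (act w o0) (act w o1) = sigma ^ w.
Proof.
move=> Ww; rewrite /xroot; case: xgetP => [v _ [Wv v0 v1]|/(_ w)]; last by case.
have Vw := W_V Ww; have E : sigma ^ (v * w^-1) = sigma.
  by apply: sigma_stab; [exact: W_M | |]; rewrite (act_M _ Wv Vw) ?v0 ?v1 actK.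
by rewrite -{2}E -conjgM mulgVK.
Qed.

(** For n = 3 the sign at the third index is forced, whence the
    disjunction. *)
Lemma W_three a b c : a.1 != b.1 -> a.1 != c.1 -> b.1 != c.1 ->
  exists w, [/\ W w, act w o0 = a, act w o1 = b & act w o2 = c \/ act w o2 = neg c].
Proof.
move=> ab ac bc.
have [||//|s [s0 s1 s2]] := @perm_of_uniq_seqs _ [:: i0; i1; i2] [:: a.1; b.1; c.1] => //.
  by rewrite /= !inE negb_or ab ac bc.
have [w [Ww fw kw]] := W_transitive s (fun i => if i == i0 then a.2 else b.2) i2.
exists w; split=> //.
- by rewrite fw // s0 /=; case: (a).
- by rewrite fw // s1 /=; case: (b).
- by apply: sidx_cases; rewrite kw s2.
Qed.

Lemma W_two a b : a.1 != b.1 -> exists w, [/\ W w, act w o0 = a & act w o1 = b].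
Proof.
move=> ab; have [k [ka kb]] := third_index a.1 b.1 hn.
rewrite eq_sym in ka; rewrite eq_sym in kb.
by have [w [Ww w0 w1 _]] := @W_three a b (k, false) ab ka kb; exists w.
Qed.

Lemma xJ a b w : a.1 != b.1 -> W w -> xroot a b ^ w = xroot (act w a) (act w b).
Proof.
move=> /W_two[v [Wv <- <-]] Ww; rewrite xE // -conjgM -xE ?act_M //.
exact: W_M.
Qed.

Lemma x_std s : xroot (s i0, false) (s i1, false) = sigma ^ rho s.
Proof. by rewrite -xE ?act_rho //; apply: W_rho. Qed.

Lemma x01 : xroot o0 o1 = sigma.
Proof. by have := x_std 1; rewrite !perm1 gmulf1 conjg1. Qed.

Lemma act_Z a : act Z a = (a.1, a.2 (+) (a.1 == i0) (+) (a.1 == i1)).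
Proof. by apply: actE; rewrite phi_Z; case: a => i e; rewrite bas_Gz. Qed.

Lemma act_z i j a : i != j -> act (z i j) a = (a.1, a.2 (+) (a.1 == i) (+) (a.1 == j)).
Proof. by move=> ij; apply: actE; rewrite phi_z //; case: a => k e; rewrite bas_Gz. Qed.

Lemma W_ZU : W (Z * U). Proof. exact: W_M W_Z (W_rho _). Qed.

Lemma act_ZU a : act (Z * U) a =
  (sU a.1, a.2 (+) (a.1 == i0) (+) (a.1 == i1)).
Proof. by rewrite act_M ?act_rho ?act_Z //; [apply: W_Z | apply: W_rho]. Qed.

Lemma act_ZU0 : act (Z * U) o0 = neg o1. Proof. by rewrite act_ZU /= sU0. Qed.
Lemma act_ZU1 : act (Z * U) o1 = neg o0. Proof. by rewrite act_ZU /= sU1. Qed.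

Lemma xK a b : a.1 != b.1 -> xroot a b * xroot a b = 1.
Proof. by move=> /W_two[w [Ww <- <-]]; rewrite xE // -conjMg sigmaK conj1g. Qed.

Lemma xV a b : a.1 != b.1 -> (xroot a b)^-1 = xroot a b.
Proof. by move=> ab; apply/eqP; rewrite eq_sym -mulg_eq1 xK. Qed.

(** ZU centralises sigma and carries the pair (0, 1) to (neg 1, neg 0). *)
Lemma x_neg a b : a.1 != b.1 -> xroot (neg b) (neg a) = xroot a b.
Proof.
move=> /W_two[w [Ww <- <-]]; rewrite xE //.
have <- : sigma ^ (Z * U) = sigma.
  by apply: conjg_commute; apply/commgP/eqP; in_relators.
rewrite -conjgM -xE; last exact: W_M W_ZU Ww.
by rewrite !(act_M _ W_ZU Ww) act_ZU0 act_ZU1 !act_neg.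
Qed.

Lemma phi_x a b : a.1 != b.1 -> phi (xroot a b) = Gx a b.
Proof.
move=> ab; have [w [Ww wa wb]] := W_two ab; rewrite -wa -wb xE // gmulfJ phi_sigma.
by apply: GxJ; rewrite ?bas_act ?act_neg ?wa ?wb.
Qed.

Lemma sigma_VU : sigma ^ (V * U) = xroot o0 o2.
Proof. by rewrite -gmulfM -x_std !permM sV0 sV1 sU1 sU2. Qed.

Lemma sigma_V : sigma ^ V = xroot o1 o2.
Proof. by rewrite -x_std sV0 sV1. Qed.

Lemma x_add_std w : W w ->
  [~ xroot (act w o0) (act w o1), xroot (act w o1) (act w o2)] = xroot (act w o0) (act w o2).
Proof.
move=> Ww; rewrite -!xJ // -conjRg; congr (_ ^ _).
rewrite x01 -sigma_V -sigma_VU; apply: divg1_eq; by in_relators.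
Qed.

(** For n = 3 the Weyl group has two orbits on triples of signed indices,
    while the relation [sigma, sigma^V] = sigma^(VU) speaks of one of them
    only. The reversed triple (neg c, neg b, neg a) describes the same
    three root elements and, having three more signs to account for, lies
    in the other orbit. *)
Lemma x_add a b c : a.1 != b.1 -> a.1 != c.1 -> b.1 != c.1 ->
  [~ xroot a b, xroot b c] = xroot a c.
Proof.
move=> ab ac bc; have [w [Ww wa wb [wc|wc]]] := W_three ab ac bc.
  by have := x_add_std Ww; rewrite wa wb wc.
(* r carries (0, 1, 2) to (2, neg 1, neg 0). *)
pose r := rho (tperm i0 i2) * z i0 i1.
have Wr : W r by apply: W_M; [apply: W_rho | apply: W_z].
have act_r d : act r d = act (z i0 i1) (tperm i0 i2 d.1, d.2).
  by rewrite act_M ?act_rho //; [apply: W_rho | apply: W_z].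
have r0 : act r o0 = o2 by rewrite act_r act_z //= tpermL.
have r1 : act r o1 = neg o1 by rewrite act_r act_z //= tpermD.
have r2 : act r o2 = neg o0 by rewrite act_r act_z //= tpermR.
have := x_add_std (W_M Wr Ww).
rewrite !(act_M _ Wr Ww) r0 r1 r2 !act_neg // wa wb wc => E.
move: E; rewrite !x_neg // => /(congr1 inv); rewrite invgR => ->.
exact: xV.
Qed.

Lemma x_src_std w : W w ->
  commute (xroot (act w o0) (act w o1)) (xroot (act w o0) (act w o2)).
Proof.
move=> Ww; rewrite -!xJ //; apply: commuteJ.
rewrite x01 -sigma_VU; apply/commgP/eqP; by in_relators.
Qed.

Lemma x_tgt_std w : W w ->
  commute (xroot (act w o0) (act w o1)) (xroot (act w o2) (act w o1)).
Proof.
move=> Ww; rewrite -!xJ //; apply: commuteJ; rewrite x01.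
have -> : xroot o2 o1 = sigma ^ (U ^ (V * U)).
  by rewrite -gmulfM -gmulfJ sUVU -x_std tpermL tpermD.
apply/commgP/eqP; by in_relators.
Qed.

(** In the orbit that does not contain the triple (0, 1, 2) the claim is
    turned, by x_neg, into the one about two root elements with the same
    target, which is another of the given relations. *)
Lemma x_src a b c : a.1 != b.1 -> a.1 != c.1 -> b.1 != c.1 ->
  commute (xroot a b) (xroot a c).
Proof.
move=> ab ac bc; have [w [Ww wa wb [wc|wc]]] := W_three ab ac bc.
  by have := x_src_std Ww; rewrite wa wb wc.
have := x_tgt_std (W_M W_ZU Ww); rewrite !(act_M _ W_ZU Ww) act_ZU0 act_ZU1.
have -> : act (Z * U) o2 = o2 by rewrite act_ZU /= sU2.
by rewrite !act_neg // wa wb wc !x_neg.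
Qed.

Lemma x_tgt a b c : a.1 != b.1 -> a.1 != c.1 -> b.1 != c.1 ->
  commute (xroot a c) (xroot b c).
Proof.
move=> ab ac bc; rewrite -[xroot a c]x_neg // -[xroot b c]x_neg //.
by apply: x_src => //=; rewrite eq_sym.
Qed.

Lemma x_opp a b : a.1 != b.1 -> commute (xroot a b) (xroot a (neg b)).
Proof.
move=> /W_two[w [Ww <- <-]]; rewrite -act_neg // -!xJ //; apply: commuteJ.
rewrite x01; have -> : xroot o0 (neg o1) = sigma ^ (Z ^ V).
  rewrite Z_V -x01 xJ //; last exact: W_z.
  by rewrite !act_z.
apply/commgP/eqP; by in_relators.
Qed.

(** For n = 4 there are again two orbits, and the relation that is imposed
    for n = 4 only covers the second one. For n > 4 a further index
    absorbs the parity. *)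
Lemma x_disj a b c d : uniq [:: a.1; b.1; c.1; d.1] -> commute (xroot a b) (xroot c d).
Proof.
move=> u; have h3 : (3 < n)%N.
  by have := max_card (mem [:: a.1; b.1; c.1; d.1]); rewrite (card_uniqP u) card_ord.
pose i3 : 'I_n := Ordinal h3; pose o3 : sidx n := (i3, false).
have V2E i j : j = i.+2 :> nat -> (sV ^+ 2) i = j.
  move=> ji; have lt_k : (i.+1 < n)%N by have := ltn_ord j; rewrite ji => /ltnW.
  by rewrite expg2 permM (@sym_V_succ _ i (Ordinal lt_k)) // (@sym_V_succ _ _ j).
have x23 : xroot o2 o3 = sigma ^ (V ^+ 2).
  by rewrite -gmulfXn -x_std (V2E i0 i2) // (V2E i1 i3).
have std w : W w -> commute (xroot (act w o0) (act w o1)) (xroot (act w o2) (act w o3)).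
  move=> Ww; rewrite -!xJ //; apply: commuteJ; rewrite x01 x23.
  by apply/commgP/eqP; apply: rels; rewrite /relators h3 !mem_cat !inE eqxx !orbT.
have [//|s [s0 s1 s2 s3]] := @perm_of_uniq_seqs _ [:: i0; i1; i2; i3] _ isT u.
have [w [Ww fw kw]] := W_transitive s
  (fun i => if i == i0 then a.2 else if i == i1 then b.2 else c.2) i3.
have wa : act w o0 = a by rewrite fw // s0 /=; case: (a).
have wb : act w o1 = b by rewrite fw // s1 /=; case: (b).
have wc : act w o2 = c by rewrite fw // s2 /=; case: (c).
have [wd|wd] : act w o3 = d \/ act w o3 = neg d by apply: sidx_cases; rewrite kw s3.
  by have := std w Ww; rewrite wa wb wc wd.
have [n4|n4] := eqVneq n 4.
  have x2n3 : xroot o2 (neg o3) = sigma ^ (Z ^ V * V ^+ 2).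
    rewrite Z_V -gmulfXn conjgM -x01 !xJ ?act_z ?act_rho //=; try exact: W_z; try exact: W_rho.
    by rewrite (V2E i0 i2) // (V2E i1 i3).
  rewrite -wa -wb -wc -[d]negK -wd -act_neg // -!xJ //; apply: commuteJ.
  rewrite x01 x2n3; apply/commgP/eqP; apply: rels.
  by rewrite /relators (introT eqP n4) !mem_cat !inE eqxx !orbT.
have h4 : (4 < n)%N by rewrite ltn_neqAle eq_sym n4.
pose i4 : 'I_n := Ordinal h4.
have Wz := W_z i3 i4.
have := std _ (W_M Wz Ww); rewrite !(act_M _ Wz Ww) !act_z //= -/o0 wa wb wc.
by rewrite -[(i3, true)]/(neg o3) act_neg // wd negK.
Qed.

(** Conjugates of U. With xroot a b such an element generates a copy of
    SL(2,2), and it reverses the root. *)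
Lemma root_reflection a b : a.1 != b.1 -> exists s : G, [/\ W s, s * s = 1,
  s * xroot a b * s = xroot a b * s * xroot a b &
  [/\ act s a = b, act s b = a & forall c, c.1 != a.1 -> c.1 != b.1 -> act s c = c]].
Proof.
move=> ab; have [w [Ww <- <-]] := W_two ab; exists (U ^ w).
have WU : W U := W_rho _; have Wv := W_V Ww.
have UU : U * U = 1 by rewrite -gmulfM tperm2 gmulf1.
have actJ c : act (U ^ w) c = act w (act U (act w^-1 c)).
  by rewrite conjgE !act_M //; apply: W_M.
split; first by rewrite conjgE; do 2?apply: W_M.
- by rewrite -conjMg UU conj1g.
- by rewrite xE // -!conjMg sigma_braid.
split.
- by rewrite actJ actK // act_rho sU0.
- by rewrite actJ actK // act_rho sU1.
move=> c; rewrite -{1 2}(actKV c Ww) !act_abs //= => c0 c1; rewrite actJ.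
suff -> : act U (act w^-1 c) = act w^-1 c by apply: actKV.
rewrite act_rho; case: (act w^-1 c) c0 c1 => i e /= c0 c1.
by rewrite tpermD // eq_sym.
Qed.

(** * Positive roots and the Bruhat decomposition *)

(** Each root has two labels (a, b) and (neg b, neg a), and exactly one of
    them has its second entry smaller in absolute value; the root is
    called positive when the first entry of that label has the positive
    sign. With this choice the simple roots are (1, neg 0) and the pairs
    (i + 1, i), so that ZU and the adjacent transpositions are the simple
    reflections. *)
Definition proot a b := (b.1 < a.1)%N && ~~ a.2.

Lemma proot_neq a b : proot a b -> a.1 != b.1.
Proof. by case/andP => ab _; apply/eqP => E; move: ab; rewrite E ltnn. Qed.

Lemma proot_same a b : ~~ a.2 -> ~~ b.2 -> a.1 = b.1 -> a = b.
Proof. by case: a b => i [] [j []] //= _ _ ->. Qed.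

(** The commutator formula for positive roots. The new root has the larger
    of a and c as its first entry, which is what the analysis of the
    unipotent subgroup by rows needs, and it differs from (a, b), which is
    what its analysis by a single simple root needs. *)
Lemma x_conj_pos a b c d : proot a b -> proot c d -> (c, d) != (a, b) ->
  xroot c d ^ xroot a b = xroot c d \/
  exists f, let e := if (a.1 < c.1)%N then c else a in
    [/\ proot e f, (e, f) != (a, b) & xroot c d ^ xroot a b = xroot c d * xroot e f].
Proof.
move=> pab pcd ne; have [ab cd] := (proot_neq pab, proot_neq pcd).
case/andP: (pab) => ba a2; case/andP: (pcd) => dc c2.
have Com : commute (xroot c d) (xroot a b) -> xroot c d ^ xroot a b = xroot c d by exact: conjg_commute.
have [dc' ba'] : (d.1 != c.1) /\ (b.1 != a.1) by split; rewrite eq_sym.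
have [ac|ac] := eqVneq a.1 c.1.
  have Eac := proot_same a2 c2 ac; subst c; left; apply: Com.
  have [bd|bd] := eqVneq b.1 d.1; last by apply/commute_sym/x_src.
  case: (sidx_cases bd) => E; last by rewrite E; apply: x_opp.
  by move: ne; rewrite E eqxx.
have ca : c.1 != a.1 by rewrite eq_sym.
have [ad|ad] := eqVneq d.1 a.1.
  have lt_ac : (a.1 < c.1)%N by rewrite -ad.
  have cb : c.1 != b.1 by apply/eqP => E; move: lt_ac; rewrite E ltnNge ltnW.
  case: (sidx_cases ad) => E.
    right; exists b; rewrite lt_ac; split.
    - by rewrite /proot c2 (ltn_trans ba).
    - by rewrite xpair_eqE negb_and; apply/orP; left; apply: contra ca => /eqP ->.
    - by rewrite conjg_mul_commg E x_add.
  left; apply: Com; rewrite E -x_neg // negK.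
  by apply: x_src; rewrite //= eq_sym.
have [bc|bc] := eqVneq b.1 c.1.
  have lt_ca : (c.1 < a.1)%N by rewrite -bc.
  have da : d.1 != a.1 by [].
  case: (sidx_cases bc) => E.
    right; exists d; rewrite ltnNge (ltnW lt_ca) /=; split.
    - by rewrite /proot a2 (ltn_trans dc).
    - rewrite xpair_eqE eqxx; apply: contra dc' => /eqP ->; by rewrite bc.
    - rewrite conjg_mul_commg E -invgR x_add // 1?eq_sym // xV // eq_sym //.
  left; apply: Com; rewrite E -(x_neg (a := a)) // negK.
  by apply/commute_sym/x_src; rewrite //= eq_sym.
have da : d.1 != a.1 by []. 
have [bd|bd] := eqVneq b.1 d.1; last first.
  left; apply/Com/commute_sym/x_disj.
  by rewrite /= !inE !negb_or ab ac bc bd cd eq_sym ad.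
case: (sidx_cases bd) => E.
  by left; apply: Com; rewrite -E; apply: x_tgt; rewrite // eq_sym.
have Ecd : xroot c d = xroot b (neg c) by rewrite -x_neg // E.
have Eac : [~ xroot c d, xroot a b] = xroot a (neg c).
  by rewrite Ecd -invgR x_add ?xV //=.
right; case: ltngtP => [lt_ac|lt_ca|/val_inj F].
- exists (neg a); split.
  + by rewrite /proot c2 lt_ac.
  + by rewrite xpair_eqE negb_and; apply/orP; left; apply: contra ca => /eqP ->.
  + by rewrite conjg_mul_commg Eac -[xroot a (neg c)]x_neg // negK.
- exists (neg c); split.
  + by rewrite /proot a2 lt_ca.
  + by rewrite xpair_eqE eqxx; apply: contra bc => /eqP <-.
  + by rewrite conjg_mul_commg Eac.
by rewrite F eqxx in ac.
Qed.

Definition xpos y := exists a b, proot a b /\ y = xroot a b.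
Definition xrest a b y := exists c d, [/\ proot c d, (c, d) != (a, b) & y = xroot c d].

Lemma xpos_x a b : proot a b -> gen xpos (xroot a b).
Proof. by move=> pab; apply: gen_in; exists a, b. Qed.

Lemma xrest_pos a b g : gen (xrest a b) g -> gen xpos g.
Proof. by apply: gen_sub => y [c [d [pcd _ ->]]]; apply: xpos_x. Qed.

Lemma xrest_J a b g : proot a b -> gen (xrest a b) g -> gen (xrest a b) (g ^ xroot a b).
Proof.
move=> pab; apply: gen_conj => y [c [d [pcd ne ->]]].
have Rcd : gen (xrest a b) (xroot c d) by apply: gen_in; exists c, d.
have [->//|[f [pef nef ->]]] := x_conj_pos pab pcd ne.
by apply: gen_mul => //; apply: gen_in; eexists; eexists; split; [exact: pef | exact: nef |].
Qed.

(** The root subgroup of any positive root normalises the subgroup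
    generated by the other positive root subgroups, by x_conj_pos. *)
Lemma pos_split a b g : proot a b -> gen xpos g ->
  exists2 h, gen (xrest a b) h & g = h \/ g = xroot a b * h.
Proof.
move=> pab; elim=> [|y g' [c [d [pcd ->]]] _ [h Rh Eg]].
  by exists 1; [apply: gen1 | left].
have [[-> ->]|/eqP ne] := pselect ((c, d) = (a, b)).
  exists h => //; case: Eg => ->; first by right.
  by left; rewrite mulgA xK ?mul1g ?proot_neq.
have Rcd : gen (xrest a b) (xroot c d) by apply: gen_in; exists c, d.
case: Eg => ->; first by exists (xroot c d * h); [apply: gen_mul | left].
exists (xroot c d ^ xroot a b * h); first by apply: gen_mul => //; apply: xrest_J.
by right; rewrite [RHS]mulgA -(conjgC (xroot c d)) mulgA.
Qed.

(** A simple root together with its reflection, characterised by the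
    property that the reflection permutes the remaining positive roots. *)
Record simple a b (s : G) : Prop := Simple {
  simple_pos : proot a b;
  simple_W : W s;
  simpleK : s * s = 1;
  simple_braid : s * xroot a b * s = xroot a b * s * xroot a b;
  simple_actL : act s a = b;
  simple_actR : act s b = a;
  simple_rest : forall c d, proot c d -> (c, d) != (a, b) -> xrest a b (xroot c d ^ s) }.

(** The action on signed indices determines an element of W, so s is the
    conjugate of U from root_reflection. *)
Lemma reflection_eq a b (s : G) : a.1 != b.1 -> W s -> act s a = b -> act s b = a ->
    (forall c, c.1 != a.1 -> c.1 != b.1 -> act s c = c) ->
  s * s = 1 /\ s * xroot a b * s = xroot a b * s * xroot a b.
Proof.
move=> ab Ws sa sb sc; have [t [Wt tK tB [ta tb tc]]] := root_reflection ab.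
suff -> : s = t by [].
apply: (W_inj Ws Wt) => c; have [ca|ca] := eqVneq c.1 a.1.
  by case: (sidx_cases ca) => ->; [|rewrite (act_neg _ Ws) (act_neg _ Wt)]; rewrite sa ta.
have [cb|cb] := eqVneq c.1 b.1.
  by case: (sidx_cases cb) => ->; [|rewrite (act_neg _ Ws) (act_neg _ Wt)]; rewrite sb tb.
by rewrite (sc c ca cb) (tc c ca cb).
Qed.

Lemma simple_tperm i j : j = i.+1 :> nat ->
  simple (j, false) (i, false) (rho (tperm i j)).
Proof.
move=> ji; have ij : i != j by apply/eqP => E; move: ji; rewrite E; lia.
have ba : ((j, false) : sidx n).1 != ((i, false) : sidx n).1 by rewrite eq_sym.
have [| | |sK sB] := @reflection_eq (j, false) (i, false) (rho (tperm i j)) ba (W_rho _).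
- by rewrite act_rho /= tpermR.
- by rewrite act_rho /= tpermL.
- by case=> k e /= kj ki; rewrite act_rho tpermD // eq_sym.
split=> //; rewrite ?act_rho /= ?tpermL ?tpermR //; try exact: W_rho.
  by rewrite /proot /= ji leqnn.
move=> [k []] [l e] /andP[//= lk _] ne.
have kl : k != l by apply/eqP => E; move: lk; rewrite E ltnn.
rewrite xJ ?act_rho //=; last exact: W_rho.
have [ki|ki] := eqVneq k i.
  subst k; rewrite tpermL tpermD; first last.
  - by apply/eqP => E; move: lk; rewrite -E ji; lia.
  - by [].
  exists (j, false), (l, e); split => //.
    by rewrite /proot /= andbT ji ltnW.
  by rewrite !xpair_eqE negb_and [l == i]eq_sym (negPf kl) orbT.
have [kj|kj] := eqVneq k j.
  subst k; rewrite tpermR.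
  have [li|li] := eqVneq l i.
    subst l; rewrite tpermL; case: e ne => ne; last by rewrite eqxx in ne.
    exists (j, false), (i, true); split => //.
      by rewrite /proot /= ji leqnn.
    by rewrite -x_neg // eq_sym.
  have il : i != l by rewrite eq_sym.
  rewrite (tpermD il kl); exists (i, false), (l, e); split => //.
    have li' : nat_of_ord l <> i by move=> E; case/eqP: li; apply: val_inj.
    by rewrite /proot /= andbT; rewrite ji in lk; lia.
  by rewrite !xpair_eqE (negPf ij).
have [ik jk] : i != k /\ j != k by split; rewrite eq_sym.
rewrite (tpermD ik jk); exists (k, false), (tperm i j l, e); split => //.
  rewrite /proot /= andbT; case: tpermP => [E|E|//].
    rewrite ltn_neqAle {2}ji -E lk andbT; apply: contra kj => /eqP E'.
    by apply/eqP/val_inj.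
  by apply: ltn_trans lk; rewrite E ji.
by rewrite !xpair_eqE (negPf kj).
Qed.

(** On the indices from 2 on ZU is trivial, and it fixes the root (1, 0). *)
Lemma simple_ZU : simple o1 (neg o0) (Z * U).
Proof.
have [| | |sK sB] := @reflection_eq o1 (neg o0) (Z * U) isT W_ZU.
- exact: act_ZU1.
- by rewrite act_neg ?act_ZU0 ?negK //; apply: W_ZU.
- move=> [k e] /= k1 k0; rewrite act_ZU /= (negPf k0) (negPf k1) !addbF.
  by rewrite tpermD // eq_sym.
have act_big k e : (1 < k)%N -> act (Z * U) (k, e) = (k, e).
  move=> k1; rewrite act_ZU /= sU_big //.
  have [/negPf -> /negPf ->] : k != i0 /\ k != i1; last by rewrite !addbF.
  by split; apply/eqP => /(congr1 val) /= E; move: k1; rewrite E.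
split=> //; [exact: W_ZU | exact: act_ZU1 | by rewrite act_neg ?act_ZU0 ?negK //; apply: W_ZU |].
move=> [k []] [l e] /andP[//= lk _] ne.
have kl : k != l by apply/eqP => E; move: lk; rewrite E ltnn.
rewrite xJ //; last exact: W_ZU.
have [k1|k1] := ltnP 1 k.
  rewrite act_big //.
  have k_i1 : k != i1 by apply/eqP => /(congr1 val) /= E; move: k1; rewrite E.
  exists (k, false), (act (Z * U) (l, e)); split => //; last by rewrite xpair_eqE [(k, _) == _]xpair_eqE (negPf k_i1).
  rewrite /proot andbT /=; have [l1|l1] := ltnP 1 l; first by rewrite act_big.
  rewrite act_ZU /= /sym_U; case: tpermP => [_|_|_ _] //=.
  exact: ltn_trans k1.
have Ek : k = i1 by apply: val_inj => /=; have : (0 < k)%N; [apply: leq_ltn_trans lk | lia].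
have El : l = i0 by apply: val_inj => /=; lia.
subst k l; case: e ne => ne; first by rewrite eqxx in ne.
rewrite act_ZU0 act_ZU1; exists o1, o0; split => //.
by rewrite x_neg.
Qed.

Lemma pos_or_neg a b : a.1 != b.1 -> gen xpos (xroot a b) \/ gen xpos (xroot b a).
Proof.
move=> ab; have ba : b.1 != a.1 by rewrite eq_sym.
case: (ltngtP (a.1 : nat) b.1) => [lt_ab|lt_ba|/val_inj E]; last by rewrite E eqxx in ab.
  case b2: b.2; last by right; apply: xpos_x; rewrite /proot lt_ab b2.
  by left; rewrite -x_neg //; apply: xpos_x; rewrite /proot /= lt_ab b2.
case a2: a.2; last by left; apply: xpos_x; rewrite /proot lt_ba a2.
by right; rewrite -x_neg //; apply: xpos_x; rewrite /proot /= lt_ba a2.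
Qed.

(** The union of the double cosets B w B, where B is generated by the
    positive root subgroups. *)
Definition cell g := exists u w v, [/\ gen xpos u, W w, gen xpos v & g = u * w * v].

Lemma cell1 : cell 1.
Proof. by exists 1, 1, 1; split; rewrite ?mulg1; [apply: gen1|apply: W1|apply: gen1|]. Qed.

Lemma cell_pos g v : cell g -> gen xpos v -> cell (g * v).
Proof.
move=> [u [w [v' [Pu Ww Pv' ->]]]] Pv; exists u, w, (v' * v).
by split=> //; [apply: gen_mul | rewrite !mulgA].
Qed.

(** The multiplication rule for double cosets. The right-hand factor v is
    split as X^e h at the simple root; h passes through s because s
    permutes the other positive roots. What happens to X depends on
    whether w carries the root to a positive or to a negative root; in the
    second case the relation s X s = X s X in SL(2,2) is used. *)
Lemma cell_simple a b (s : G) g : simple a b s -> cell g -> cell (g * s).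
Proof.
move=> Ss [u [w [v [Pu Ww Pv ->]]]].
have [pab Ws sK sB sL sR srest] := Ss; have ab := proot_neq pab.
have sinv : s^-1 = s by apply/eqP; rewrite eq_sym -mulg_eq1 sK.
have [h Rh Ev] := pos_split pab Pv.
have Ph : gen xpos (h ^ s).
  apply: xrest_pos (_ : gen (xrest a b) _); apply: gen_conj Rh => y [c [d [pcd ne ->]]].
  exact/gen_in/srest.
have hs : h * s = s * h ^ s by rewrite -conjgC.
have Px := xpos_x pab.
have Wws : W (w * s) by apply: W_M.
case: Ev => ->.
  by exists u, (w * s), (h ^ s); split=> //; rewrite -!mulgA hs.
have xw (t : G) : W t -> t * xroot a b = xroot a b ^ t^-1 * t.
  by move=> Wt; rewrite conjgE invgK !mulgA mulgVK.
have awb : (act w^-1 a).1 != (act w^-1 b).1 by rewrite act_abs //; apply: W_V.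
have [Pxw|Nxw] := pos_or_neg awb.
  rewrite -xJ // in Pxw; last exact: W_V.
  exists (u * xroot a b ^ w^-1), (w * s), (h ^ s); split=> //; first exact: gen_mul.
  exact: cell_calc1 hs (xw w Ww).
(* Here w carries the root to a negative root, so w s carries it to a
   positive one, and w = (w s) s. *)
have Wi : W (w * s)^-1 by apply: W_V.
have Pxw : gen xpos (xroot a b ^ (w * s)^-1).
  rewrite xJ // invgM sinv !act_M ?sL ?sR //; exact: W_V.
exists (u * xroot a b ^ (w * s)^-1), w, (xroot a b * h ^ s); split; try exact: gen_mul.
  exact: Ww.
exact: cell_calc2 hs sK sB (xw _ Wws).
Qed.

Lemma cell_W g w : W w -> cell g -> cell (g * w).
Proof.
have Pr s : forall g, cell g -> cell (g * rho s).
  apply: (@sym_tail_ind _ (fun s => forall g, cell g -> cell (g * rho s)) 0) => //.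
  - by move=> g' Cg; rewrite gmulf1 mulg1.
  - by move=> s1 s2 C1 C2 g' Cg; rewrite gmulfM mulgA; apply/C2/C1.
  - by move=> i j _ ji g' Cg; apply: cell_simple (simple_tperm ji) Cg.
have PZ g' : cell g' -> cell (g' * Z).
  move=> Cg; have -> : Z = Z * U * U by rewrite -mulgA -gmulfM tperm2 gmulf1 mulg1.
  by rewrite mulgA; apply/Pr/(cell_simple simple_ZU).
have Pz i j g' : cell g' -> cell (g' * z i j).
  have [->|ij] := eqVneq i j; first by rewrite zii mulg1.
  rewrite -(zperm0 ij) -[X in z _ X](zperm1 i j) zE conjgE -gmulfV !mulgA => Cg.
  exact/Pr/PZ/Pr.
case=> L [s ->] Cg; rewrite mulgA; apply: Pr.
elim: L g Cg => [|j L IH] g Cg; first by rewrite /zprod iprod_nil mulg1.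
by rewrite /zprod iprod_cons mulgA; apply/IH/Pz.
Qed.

Lemma cell_sigma g : cell g -> cell (g * sigma).
Proof.
have WU : W U := W_rho _.
have -> : sigma = U^-1 * (xroot o1 o0 * U).
  by rewrite -conjgE xJ // !act_rho /= sU0 sU1 x01.
move=> Cg; rewrite (mulgA g) (mulgA (g * _)); apply: cell_W => //; apply: cell_pos; last exact: xpos_x.
by apply: cell_W => //; apply: W_V.
Qed.

(** * Faithfulness: the unipotent part is triangular *)

(** An order on the basis, f_(n-1) < ... < f_0 < e_0 < ... < e_(n-1), in
    which positive root elements add to a basis vector only smaller ones. *)
Definition height a : nat := if a.2 then (n - a.1.+1)%N else (n + a.1)%N.

Lemma height_proot a b : proot a b -> (height b < height a)%N.
Proof.
move=> /andP[ba /negPf a2]; rewrite /height a2; have := ltn_ord a.1.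
by case: b.2; lia.
Qed.

Lemma height_neg a b : proot a b -> (height (neg a) < height (neg b))%N.
Proof.
move=> /andP[ba /negPf a2]; rewrite /height /= a2 /=; have := ltn_ord a.1.
case: b.2 => /= an; first by lia.
by apply: ltn_sub2l; rewrite ?ltnS //; apply: leq_ltn_trans an.
Qed.

Definition leads (a : sidx n) (v : 'rV['F_2]_(n + n)) :=
  forall b, (height a <= height b)%N -> co v b = (b == a)%:R.

Lemma pos_leads g a v : gen xpos g -> leads a v -> leads a (v *m val (phi g)).
Proof.
move=> Pg; elim: Pg v => [|y g' [c [d [pcd ->]]] _ IH] v va; first by rewrite gmulf1 mulmx1.
rewrite gmulfM GO_valM mulmxA; apply: IH => b ab.
have cd := proot_neq pcd; rewrite phi_x // mul_Gx // !(coD, coZ, co_bas) va //.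
have zero e : (height a < height e)%N -> co v e = 0%R.
  move=> ae; rewrite va ?(ltnW ae) //; case: eqP => // E.
  by move: ae; rewrite E ltnn.
have -> : (co v c * (b == d)%:R = 0)%R.
  have [bd|_] := eqVneq b d; last by rewrite mulr0.
  by rewrite zero ?mul0r //; apply: leq_ltn_trans ab _; rewrite bd height_proot.
have -> : (co v (neg d) * (b == neg c)%:R = 0)%R.
  have [bd|_] := eqVneq b (neg c); last by rewrite mulr0.
  by rewrite zero ?mul0r //; apply: leq_ltn_trans ab _; rewrite bd height_neg.
by rewrite !addr0.
Qed.

Lemma pos_diag g a : gen xpos g -> co (bas a *m val (phi g)) a = 1%R.
Proof.
move=> Pg; rewrite (pos_leads Pg (a := a)) ?eqxx // => b _.
by rewrite co_bas.
Qed.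

Lemma xpos_inv g : gen xpos g -> gen xpos g^-1.
Proof. by apply: gen_inv => y [a [b [pab ->]]]; apply/xK/proot_neq. Qed.

(** If u w v acts trivially, then w acts as a unitriangular matrix; being
    a signed permutation it acts as the identity, and w = 1 by
    act_faithful. *)
Lemma cell_kernel g : cell g -> phi g = 1 -> gen xpos g.
Proof.
move=> [u [w [v [Pu Ww Pv ->]]]] E.
suff -> : w = 1 by rewrite mulg1; apply: gen_mul.
apply: act_faithful => // a.
have Ew : phi w = phi (u^-1 * v^-1).
  have {1}-> : w = u^-1 * (u * w * v) * v^-1 by rewrite !mulgA mulVg mul1g mulgK.
  by rewrite gmulfM gmulfM E mulg1 -gmulfM.
have := pos_diag a (gen_mul (xpos_inv Pu) (xpos_inv Pv)).
rewrite -Ew bas_act // co_bas; case: eqP => // _ /eqP.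
Qed.

(** The unipotent subgroup is filtered by the absolute value of the first
    entry of the positive roots. *)
Definition xlow (m : nat) y := exists a b, [/\ proot a b, (a.1 < m)%N & y = xroot a b].

Lemma row_commute i a b : (a.1 < i)%N -> (b.1 < i)%N ->
  commute (xroot (i, false) a) (xroot (i, false) b).
Proof.
move=> ai bi; have ia : i != a.1 by apply/eqP => E; move: ai; rewrite -E ltnn.
have ib : i != b.1 by apply/eqP => E; move: bi; rewrite -E ltnn.
have [ab|ab] := eqVneq b.1 a.1; last by apply: x_src => //; rewrite eq_sym.
case: (sidx_cases ab) => ->; first exact: commute_refl.
exact: x_opp.
Qed.

Definition rowprod i (L : seq (sidx n)) := iprod (xroot (i, false)) L.
Definition below i : pred (sidx n) := fun a => (a.1 < i)%N.

Lemma rowprod_J i L c d : all (below i) L -> proot c d -> (c.1 < i)%N ->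
  exists2 L', all (below i) L' & rowprod i L ^ xroot c d = rowprod i L'.
Proof.
move=> + pcd ci; elim: L => [|a L IH] /=.
  by exists [::]; rewrite // /rowprod iprod_nil conj1g.
case/andP=> ai /IH[L' bL' E]; rewrite /rowprod iprod_cons conjMg E.
have pia : proot (i, false) a by rewrite /proot /= andbT.
have ne : ((i, false), a) != (c, d).
  by rewrite xpair_eqE negb_and; apply/orP; left; apply/eqP => E'; move: ci; rewrite -E' ltnn.
have [->|[f]] := x_conj_pos pcd pia ne.
  by exists (a :: L'); rewrite /= ?ai // iprod_cons.
rewrite /= ci => -[/andP[fi _] _ ->]; exists [:: a, f & L'].
  by rewrite /= ai bL' [below i f]fi.
by rewrite !iprod_cons !mulgA.
Qed.

(** The roots with first entry (i, false) generate a subgroup that is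
    normalised by the lower rows, and this subgroup is elementary abelian. *)
Lemma low_split i g : gen (xlow i.+1) g ->
  exists L h, [/\ all (below i) L, gen (xlow i) h & g = rowprod i L * h].
Proof.
elim=> [|y g' [c [d [pcd ci ->]]] _ [L [h [bL Kh ->]]]].
  by exists [::], 1; rewrite /rowprod iprod_nil mulg1; split=> //; apply: gen1.
have [cE|cE] := eqVneq c.1 i.
  have -> : c = (i, false) by apply: proot_same => //; case/andP: pcd.
  exists (d :: L), h; rewrite /rowprod iprod_cons mulgA; split=> //=.
  by rewrite bL andbT /below -cE; case/andP: pcd.
have lt_ci : (c.1 < i)%N by rewrite ltn_neqAle cE.
have [L' bL' E] := rowprod_J bL pcd lt_ci.
exists L', (xroot c d * h); split=> //.
  by apply: gen_mul => //; apply: gen_in; exists c, d.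
have [XK XV] := (xK (proot_neq pcd), xV (proot_neq pcd)).
move: (xroot c d) E XK XV => X E XK XV.
by rewrite -E conjgE XV -!mulgA (mulgA X X h) XK mul1g.
Qed.

(** The image of e_i under a product of elements of row i records which
    factors occur. *)
Lemma co_rowprod i L v a : all (below i) L -> (a.1 < i)%N -> co v (i, false) = 1%R ->
  co (v *m val (phi (rowprod i L))) a = (co v a + (odd (count_mem a L))%:R)%R.
Proof.
move=> bL ai; elim: L v bL => [|b L IH] v /=.
  by rewrite /rowprod iprod_nil gmulf1 mulmx1 addr0.
case/andP=> bi bL v1; rewrite /rowprod iprod_cons gmulfM GO_valM mulmxA.
have ne (e : sidx n) : (e.1 < i)%N -> ((i, false) : sidx n).1 != e.1.
  by move=> ei; apply/eqP => E; move: ei; rewrite -E ltnn.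
rewrite phi_x ?ne // IH // mul_Gx ?ne // !(coD, coZ, co_bas) v1.
  rewrite !(sidx_neqF (ne _ ai)) mulr0 addr0 -addrA oddD mul1r; congr (_ + _)%R.
  by rewrite [b == a]eq_sym; case: (a == b); case: (odd _); apply/eqP.
by rewrite !(sidx_neqF (ne _ bi), neg_eqF) !mulr0 !addr0.
Qed.

Lemma low_fixes i h : gen (xlow i) h -> bas (i, false) *m val (phi h) = bas (i, false).
Proof.
elim=> [|y g' [c [d [pcd ci ->]]] _ IH]; first by rewrite gmulf1 mulmx1.
have cd := proot_neq pcd; rewrite gmulfM GO_valM mulmxA phi_x // mul_Gx // !co_bas.
have di : (d.1 < i)%N by apply: ltn_trans ci; case/andP: pcd.
have cF : c.1 != ((i, false) : sidx n).1 by apply/eqP => E; move: ci; rewrite E ltnn.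
have dF : d.1 != ((i, false) : sidx n).1 by apply/eqP => E; move: di; rewrite E ltnn.
by rewrite !(sidx_neqF cF, sidx_neqF dF) !scale0r !addr0.
Qed.

Lemma xlow_inv (m : nat) g : gen (xlow m) g -> gen (xlow m) g^-1.
Proof. by apply: gen_inv => y [a [b [pab _ ->]]]; apply/xK/proot_neq. Qed.

(** Row by row: the elements of lower rows fix e_i, so the image of e_i
    determines the factor from row i, which is therefore trivial. *)
Lemma low_kernel (m : nat) g : (m <= n)%N -> gen (xlow m) g -> phi g = 1 -> g = 1.
Proof.
elim: m g => [|m IH] g lt_j Kg; first by case: Kg => // y g' [a [b []]].
pose i : 'I_n := Ordinal lt_j.
have [L [h [bL Kh ->]]] := @low_split i g Kg => E.
have below_x a : below i a -> xroot (i, false) a * xroot (i, false) a = 1.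
  by move=> ai; apply: xK; apply/eqP => E'; move: ai; rewrite /below -E' ltnn.
have [L' [uL' sL' EL]] := iprod_uniq below_x (@row_commute i) bL.
have bL' : all (below i) L' by apply/allP => a /sL' /(allP bL).
rewrite /rowprod EL -/(rowprod i L') in E *.
have fix_i : bas (i, false) *m val (phi (rowprod i L')) = bas (i, false).
  rewrite -[rowprod i L'](mulgK h) gmulfM E mul1g.
  exact/low_fixes/xlow_inv.
have L0 : L' = [::].
  case: L' uL' bL' {sL' EL E} fix_i => // a L' uL' bL' fix_i.
  have ai : (a.1 < i)%N by case/andP: bL'.
  have := @co_rowprod i (a :: L') (bas (i, false)) a bL' ai.
  rewrite fix_i !co_bas eqxx => /(_ erefl) /eqP.
  by rewrite -subr_eq0 opprD addrA subrr add0r count_uniq_mem // mem_head.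
rewrite L0 /rowprod iprod_nil mul1g in E *.
exact: IH (ltnW lt_j) Kh E.
Qed.

Lemma kernel_trivial g : cell g -> phi g = 1 -> g = 1.
Proof.
move=> Cg Eg; apply: (low_kernel (leqnn n)) => //.
by apply: gen_sub (cell_kernel Cg Eg) => y [a [b [pab ->]]]; apply: gen_in; exists a, b.
Qed.

End Presented.

(** * The isometries satisfy the relators *)

Section AllTrivial.
Variable G : groupType.
Implicit Types (r : G) (L : seq G).

(** A one-constructor wrapper around the membership statement, so that
    unification does not see through it when the list of relators is taken
    apart. *)
Variant trivial L : Prop := Trivial of forall r, r \in L -> r = 1.

Lemma trivial_nil : trivial [::]. Proof. by []. Qed.
Lemma trivial_cons r L : r = 1 -> trivial L -> trivial (r :: L).
Proof. by move=> r1 [L1]; split=> q; rewrite inE => /orP[/eqP -> | /L1]. Qed.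
Lemma trivial_cat L1 L2 : trivial L1 -> trivial L2 -> trivial (L1 ++ L2).
Proof. by move=> [T1] [T2]; split=> q; rewrite mem_cat => /orP[/T1 | /T2]. Qed.
Lemma trivial_if (b : bool) L : (b -> trivial L) -> trivial (if b then L else [::]).
Proof. by case: b => // T; apply: T. Qed.
Lemma commg_conj (g h : G) : g ^ h = g -> [~ g, h] = 1.
Proof. by move=> E; apply/eqP/conjg_fixP. Qed.
Lemma commg_commute (g h : G) : commute g h -> [~ g, h] = 1.
Proof. by move=> E; apply/eqP/commgP. Qed.
Lemma divg_triv (g h : G) : g = h -> g * h^-1 = 1.
Proof. by move=> ->; apply: mulgV. Qed.
End AllTrivial.

Section OrthogonalRelators.
Variables (n : nat) (hn : (2 < n)%N).
Local Notation i0 := (i0 hn).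
Local Notation i1 := (i1 hn).
Local Notation i2 := (i2 hn).
Local Notation sU := (sym_U hn).
Local Notation sV := (sym_V n).
Local Notation o0 := ((i0, false) : sidx n).
Local Notation o1 := ((i1, false) : sidx n).
Implicit Types (i j k l : 'I_n) (s : {perm 'I_n}).

Lemma Gz_commute i j k l : commute (Gz i j) (Gz k l).
Proof.
suff E : Gz i j * Gz k l = Gz k l * Gz i j by exact: E.
apply: GO_inj => -[m e]; rewrite 2!GO_valM 2!mulmxA !bas_Gz.
by case: e; case: (m == i); case: (m == j); case: (m == k); case: (m == l).
Qed.

Lemma GzC i j : Gz i j = Gz j i.
Proof. by apply: GO_inj => -[m e]; rewrite !bas_Gz addbAC. Qed.

Lemma GzK i j : Gz i j * Gz i j = 1.
Proof.
apply: GO_inj => -[m e]; rewrite GO_valM mulmxA !bas_Gz mulmx1.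
by case: e; case: (m == i); case: (m == j).
Qed.

Lemma GzM i j k : Gz i j * Gz j k = Gz i k.
Proof.
apply: GO_inj => -[m e]; rewrite GO_valM mulmxA !bas_Gz.
by case: e; case: (m == i); case: (m == j); case: (m == k).
Qed.

Lemma Gx_Gs s i j e f : i != j ->
  Gx (i, e) (j, f) ^ Gs s = Gx (s i, e) (s j, f).
Proof.
move=> ij; apply: GxJ => //=; rewrite ?(inj_eq perm_inj) //; last by rewrite bas_Gs.
by rewrite /neg /= bas_Gs.
Qed.

Lemma Gx_Gz i j e f k l : i != j -> Gx (i, e) (j, f) ^ Gz k l =
  Gx (i, e (+) (i == k) (+) (i == l)) (j, f (+) (j == k) (+) (j == l)).
Proof.
move=> ij; apply: GxJ => //=; rewrite /neg /= bas_Gz //.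
by rewrite !addNb.
Qed.

Lemma GO_relators r : r \in relators n (Gx o0 o1) (Gz i0 i1) (Gs sU) (Gs sV) -> r = 1.
Proof.
have i01 : i0 != i1 by [].
have i12 : i1 != i2 by [].
have i02 : i0 != i2 by [].
have ZV : Gz i0 i1 ^ Gs sV = Gz i1 i2 by rewrite GzJ sV0 sV1.
have V2 j k : j = k.+2 :> nat -> (sV ^+ 2) k = j.
  move=> ji; have lt_k : (k.+1 < n)%N by have := ltn_ord j; rewrite ji => /ltnW.
  by rewrite expg2 permM (@sym_V_succ _ k (Ordinal lt_k)) // (@sym_V_succ _ _ j).
have tailE s : s i0 = i0 -> s i1 = i1 ->
    Gz i0 i1 ^ Gs s = Gz i0 i1 /\ Gx o0 o1 ^ Gs s = Gx o0 o1.
  by move=> s0 s1; rewrite GzJ Gx_Gs // s0 s1.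
have tail3 : (3 < n)%N -> Gz i0 i1 ^ (Gs sU ^ (Gs sV ^+ 2)) = Gz i0 i1 /\
    Gx o0 o1 ^ (Gs sU ^ (Gs sV ^+ 2)) = Gx o0 o1.
  move=> h3; rewrite -gmulfXn -gmulfJ; apply: tailE.
    by rewrite tpermJ (@V2 i2) // (@V2 (Ordinal h3)) // tpermD.
  by rewrite tpermJ (@V2 i2) // (@V2 (Ordinal h3)) // tpermD.
have tailc : Gs sV * Gs sU * Gs sU ^ Gs sV = Gs (sV * sU * sU ^ sV).
  by rewrite 2!gmulfM gmulfJ.
have [c0 c1] : (sV * sU * sU ^ sV) i0 = i0 /\ (sV * sU * sU ^ sV) i1 = i1.
  by rewrite sUV !permM sV0 sV1 sU1 sU2 tpermR tpermD.
have ZV2 (h3 : (3 < n)%N) : Gz i0 i1 ^ (Gs sV ^+ 2) = Gz i2 (Ordinal h3).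
  by rewrite -gmulfXn GzJ (@V2 i2) // (@V2 (Ordinal h3)).
have sVU : Gx o0 o1 ^ (Gs sV * Gs sU) = Gx o0 (i2, false).
  by rewrite -gmulfM Gx_Gs // !permM sV0 sV1 sU1 sU2.
suff [R1] : trivial (relators n (Gx o0 o1) (Gz i0 i1) (Gs sU) (Gs sV)) by exact: R1.
rewrite /relators.
apply: trivial_cat.
  apply: trivial_if => h3; apply: trivial_cons; last apply: trivial_cons; last exact: trivial_nil.
    exact: commg_conj (tail3 h3).1.
  by apply: commg_commute; rewrite ZV2; apply: Gz_commute.
apply: trivial_cat.
  apply: trivial_if => h4; apply: trivial_cons; last exact: trivial_nil.
  by rewrite tailc; apply: commg_conj (tailE _ c0 c1).1.
apply: trivial_cat.
  apply: trivial_cons; first by rewrite expg2 GzK.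
  apply: trivial_cons; first by apply: divg_triv; rewrite ZV GzM -gmulfJ sUV GzJ tpermL tpermD.
  apply: trivial_cons; first by apply: commg_conj; rewrite GzJ sU0 sU1 GzC.
  apply: trivial_cons; last exact: trivial_nil.
  by apply: commg_commute; rewrite ZV; apply: Gz_commute.
apply: trivial_cat.
  apply: trivial_if => h3; apply: trivial_cons; last apply: trivial_cons; last exact: trivial_nil.
    exact: commg_conj (tail3 h3).2.
  by apply: commg_conj; rewrite ZV2 Gx_Gz.
apply: trivial_cat.
  apply: trivial_if => h4; apply: trivial_cons; last exact: trivial_nil.
  by rewrite tailc; apply: commg_conj (tailE _ c0 c1).2.
apply: trivial_cat.
  apply: trivial_cons; last exact: trivial_nil.
  apply: commg_conj; rewrite conjgM Gx_Gz // Gx_Gs // sU0 sU1.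
  by rewrite -Gx_neg.
apply: trivial_cat.
  apply: trivial_cons; first by apply: divg_triv; rewrite sVU Gx_Gs // sV0 sV1 GxR.
  apply: trivial_cons; first by apply: commg_commute; rewrite sVU; apply: GxC.
  apply: trivial_cons.
    apply: commg_commute; rewrite -gmulfM -gmulfJ sUVU Gx_Gs // tpermL tpermD //.
    exact: GxC.
  apply: trivial_cons; last exact: trivial_nil.
  by apply: commg_commute; rewrite ZV Gx_Gz //; apply: (@Gx_opp _ o0 o1).
apply: trivial_cat.
  apply: trivial_if => h3; apply: trivial_cons; last exact: trivial_nil.
  apply: commg_commute; rewrite -gmulfXn Gx_Gs // (@V2 i2) // (@V2 (Ordinal h3)) //.
  exact: GxC.
apply: trivial_if => /eqP n4; have h3 : (3 < n)%N by rewrite n4.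
apply: trivial_cons; last exact: trivial_nil.
apply: commg_commute.
rewrite conjgM ZV Gx_Gz // -gmulfXn Gx_Gs // (@V2 i2) // (@V2 (Ordinal h3)) //.
exact: GxC.
Qed.

End OrthogonalRelators.

(** * Words and homomorphisms *)

Section BraidWords.
Variables (H : groupType) (a b : H).
Hypotheses (aK : a * a = 1) (bK : b * b = 1) (braid : b * a * b = a * b * a).

(** The six elements of SL(2,2), that is of the symmetric group on three
    letters, as words in two involutions satisfying the braid relation. *)
Definition braid_nf (k : nat) : H :=
  nth 1 [:: 1; a; b; a * b; b * a; a * b * a] k.

Lemma braid_nf_mull k : (k < 6)%N ->
  a * braid_nf k = braid_nf (nth 0 [:: 1; 0; 3; 2; 5; 4] k)%N.
Proof.
case: k => [|[|[|[|[|[|//]]]]]] _; rewrite /braid_nf /= ?mulg1 //.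
- by rewrite mulgA aK mul1g.
- by rewrite mulgA.
- by rewrite !mulgA aK mul1g.
Qed.

Lemma braid_nf_mulr k : (k < 6)%N ->
  b * braid_nf k = braid_nf (nth 0 [:: 2; 4; 0; 5; 1; 3] k)%N.
Proof.
case: k => [|[|[|[|[|[|//]]]]]] _; rewrite /braid_nf /= ?mulg1 //.
- by rewrite mulgA braid.
- by rewrite mulgA bK mul1g.
- by rewrite -braid !mulgA bK mul1g.
Qed.

(** The reduction of a word to one of the six normal forms. It does not
    depend on the group, so two groups with such generators can be
    compared word by word. *)
Definition braid_code (w : seq ('I_2 * bool)) : nat :=
  foldr (fun x k => nth 0 (if x.1 == ord0 then [:: 1; 0; 3; 2; 5; 4] else [:: 2; 4; 0; 5; 1; 3]) k)%N 0%N w.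

Lemma braid_code_lt w : (braid_code w < 6)%N.
Proof.
elim: w => //= x w; case: (braid_code w) => [|[|[|[|[|[|//]]]]]] _; by case: ifP.
Qed.

Lemma fg_eval_braid (r : free_group 2) :
  fg_eval [tuple a; b] r = braid_nf (braid_code (val r)).
Proof.
rewrite /fg_eval; elim: (val r) => [|[i e] w IH]; first by rewrite big_nil.
have inv_of (c : H) : c * c = 1 -> c^-1 = c.
  by move=> cK; apply/eqP; rewrite eq_sym -mulg_eq1 cK.
rewrite big_cons IH /=; have lt6 := braid_code_lt w.
have -> : leval [tuple a; b] (i, e) = if i == ord0 then a else b.
  rewrite /leval /=; case: i => [[|[|//]] ?]; rewrite (tnth_nth a) /=;
  by case: e => //; apply: inv_of.
by case: ifP => _; [apply: braid_nf_mull | apply: braid_nf_mulr].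
Qed.

(** If none of a, b and a * b is trivial, the six normal forms are
    different from 1 except for the first one. *)
Lemma braid_nf_eq1 k : a != 1 -> b != 1 -> a != b -> (k < 6)%N ->
  braid_nf k = 1 -> k = 0%N.
Proof.
move=> a1 b1 ab; case: k => [|[|[|[|[|[|//]]]]]] _ //; rewrite /braid_nf /= => E.
- by rewrite E eqxx in a1.
- by rewrite E eqxx in b1.
- by case/eqP: ab; rewrite -[b]mul1g -aK -mulgA E mulg1.
- by case/eqP: ab; rewrite -[a]mul1g -bK -mulgA E mulg1.
- case/eqP: b1; have -> : b = a * (a * b * a) * a.
    by rewrite !mulgA aK mul1g -mulgA aK mulg1.
  by rewrite E mulg1 aK.
Qed.
End BraidWords.

Lemma SL2_braid : [/\ SL2_sigma * SL2_sigma = 1, SL2_U * SL2_U = 1 &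
  SL2_U * SL2_sigma * SL2_U = SL2_sigma * SL2_U * SL2_sigma].
Proof.
have E (A B : 'M['F_2]_2) : A 0%R 0%R = B 0%R 0%R -> A 0%R 1%R = B 0%R 1%R -> A 1%R 0%R = B 1%R 0%R -> A 1%R 1%R = B 1%R 1%R -> A = B.
  move=> a b c d; apply/matrixP => i j.
  have [-> | ->] : i = 0%R \/ i = 1%R by case: i => [[|[|//]] ?]; [left|right]; apply/val_inj.
    by have [-> | ->] : j = 0%R \/ j = 1%R by case: j => [[|[|//]] ?]; [left|right]; apply/val_inj.
  by have [-> | ->] : j = 0%R \/ j = 1%R by case: j => [[|[|//]] ?]; [left|right]; apply/val_inj.
have mul2 (A B : 'M['F_2]_2) i j : (A *m B) i j = (A i 0 * B 0 j + A i 1 * B 1 j)%R.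
  rewrite mxE !big_ord_recl big_ord0 addr0; congr (_ + A _ _ * B _ _)%R; exact: val_inj.
have [sK uK sus] : [/\ sigma2_mx *m sigma2_mx = 1%:M, U2_mx *m U2_mx = 1%:M &
    U2_mx *m sigma2_mx *m U2_mx = sigma2_mx *m U2_mx *m sigma2_mx].
  by split; apply: E; rewrite !mul2 !mxE; apply/eqP.
by split; apply: val_inj; rewrite !FinRing.val_unitM.
Qed.

Lemma SL2_neq : [/\ SL2_sigma != 1, SL2_U != 1 & SL2_sigma != SL2_U].
Proof.
split; apply/eqP => /(congr1 val)/matrixP E; first 2 last.
- by have := E 0%R 0%R; rewrite !mxE => /eqP.
- by have := E 0%R 1%R; rewrite !mxE => /eqP.
- by have := E 0%R 1%R; rewrite !mxE => /eqP.
Qed.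

(** The universal property of a surjection: f' factors through f. *)
Lemma factor_hom (F K H : groupType) (f : UMagmaMorphism.type F K)
    (f' : UMagmaMorphism.type F H) :
  (forall y, exists a, f a = y) -> (forall a, f a = 1 -> f' a = 1) ->
  exists h : UMagmaMorphism.type K H, forall a, h (f a) = f' a.
Proof.
move=> fsurj kerf; pose h y := f' (xget 1 [set a | f a = y]).
have hE a : h (f a) = f' a.
  rewrite /h; case: xgetP => [c _ /= fc|/(_ a) []//].
  by apply/divg1_eq; rewrite -gmulfF kerf // gmulfF fc mulgV.
have h1 : h 1 = 1 by rewrite -(gmulf1 (s := f)) hE gmulf1.
have hM : {morph h : x y / x * y}.
  move=> x y; have [a <-] := fsurj x; have [b <-] := fsurj y.
  by rewrite -gmulfM !hE gmulfM.
pose hm := isUMagmaMorphism.Build K H h (conj h1 hM).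
by exists (HB.pack_for (UMagmaMorphism.type K H) h hm).
Qed.

Lemma fg_eval_gens k (a : free_group k) :
  fg_eval [tuple (@fg_gen k i) | i < k] a = a.
Proof.
apply: val_inj; rewrite /fg_eval -[RHS](wmuls0 (valP a)).
elim: (val a) => [|x w IH]; first by rewrite big_nil.
rewrite big_cons /= IH /leval tnth_mktuple.
by case: x => i [].
Qed.

Lemma presents_kernel (K H : groupType) k (g : k.-tuple K) (g' : k.-tuple H) R :
  presents g R -> (forall r, R r -> fg_eval g' r = 1) ->
  forall a, fg_eval g a = 1 -> fg_eval g' a = 1.
Proof.
move=> pR gR a ga; apply: (normal_closure_ker gR).
by rewrite pR.
Qed.

Lemma presents_rel (K : groupType) k (g : k.-tuple K) R r :
  presents g R -> R r -> fg_eval g r = 1.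
Proof.
move=> pR Rr; suff : normal_closure R r by rewrite pR.
by apply: sub_gen_smallest.
Qed.

Lemma relators_map (G H : groupType) (f : UMagmaMorphism.type G H) n (a b c d : G) :
  map f (relators n a b c d) = relators n (f a) (f b) (f c) (f d).
Proof.
rewrite /relators !map_cat !(fun_if (map f)) /=.
by rewrite !(gmulfR, gmulfJ, gmulfM, gmulfV, gmulfXn).
Qed.

(** * The isomorphism *)

(** Conjugation by the powers of V turns U into all the adjacent
    transpositions. *)
Lemma sym_generated n (hn : (2 < n)%N) s :
  exists a, fg_eval [tuple sym_U hn; sym_V n] a = s.
Proof.
pose gU : free_group 2 := fg_gen ord0; pose gV : free_group 2 := fg_gen ord_max.
have EU : fg_eval [tuple sym_U hn; sym_V n] gU = sym_U hn by rewrite fg_eval_gen.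
have EV : fg_eval [tuple sym_U hn; sym_V n] gV = sym_V n by rewrite fg_eval_gen.
apply: (@sym_tail_ind _ (fun s => exists a, fg_eval [tuple sym_U hn; sym_V n] a = s) 0) => //.
- by exists 1; rewrite gmulf1.
- by move=> x y [a <-] [b <-]; exists (a * b); rewrite gmulfM.
move=> i j _ ji; exists (gU ^ (gV ^+ i)); rewrite gmulfJ gmulfXn /= EU EV tpermJ.
have iter k (l : 'I_n) (lt_k : (l + k < n)%N) : (sym_V n ^+ k) l = Ordinal lt_k.
  elim: k lt_k => [|k IH] lt_k; first by rewrite perm1; apply: val_inj; rewrite /= addn0.
  have lt_k' : (l + k < n)%N by rewrite addnS in lt_k; apply: ltnW.
  by rewrite expgSr permM (IH lt_k'); apply: sym_V_succ; rewrite /= addnS.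
have lt0 : (i0 hn + i < n)%N by rewrite add0n.
have lt1 : (i1 hn + i < n)%N by rewrite add1n -ji.
rewrite -/(i0 hn) -/(i1 hn) (iter _ _ lt0) (iter _ _ lt1).
by congr tperm; apply: val_inj; rewrite /= ?add0n ?add1n.
Qed.

Lemma quotient_hom (G H : groupType) (R : set G) (f : UMagmaMorphism.type G H) :
  (forall r, R r -> f r = 1) ->
  exists h : UMagmaMorphism.type (Defs.quotient_group R) H, forall x, h (qg_mk R x) = f x.
Proof.
move=> fR; pose mk : UMagmaMorphism.type G (Defs.quotient_group R) := qg_mk R.
apply: (@factor_hom _ _ _ mk f) => [y|a]; first by exists (generic_quotient.repr y); apply: qg_mkK.
move=> E; apply: (normal_closure_ker fR).
have /qg_mkP : qg_mk R a^-1 = qg_mk R 1 by rewrite gmulfV [X in X^-1]E invg1 gmulf1.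
by rewrite invgK mulg1.
Qed.

Lemma word_ind k (H : groupType) (g : k.-tuple H) (P : H -> Prop) :
    P 1 -> (forall h i, P h -> P (h * tnth g i)) ->
    (forall h i, P h -> P (h * (tnth g i)^-1)) ->
  forall a, P (fg_eval g a).
Proof.
move=> P1 Pg Pv a; rewrite /fg_eval; elim/last_ind: (val a) => [|w x IH].
  by rewrite big_nil.
rewrite -cats1 big_cat big_seq1 /leval.
by case: x => i []; [apply: Pv | apply: Pg].
Qed.

Lemma refl_prod_Gz n (i j : 'I_n) : refl_prod false (Gz i j).
Proof.
rewrite /Gz -lock; apply: (@refl_prodM _ true true);
by apply: refl_prod_Gt; apply: flip_quad.
Qed.

Section Assembly.
Variables (n : nat) (hn : (2 < n)%N) (RS RL : set (free_group 2)).
Hypothesis hRS : presents [tuple sym_U hn; sym_V n] RS.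
Hypothesis hRL : presents [tuple SL2_sigma; SL2_U] RL.

Local Notation R := (Omega_relators n RS RL).
Local Notation G := (presented_group R).
Local Notation o0 := ((i0 hn, false) : sidx n).
Local Notation o1 := ((i1 hn, false) : sidx n).

Let mk : UMagmaMorphism.type (free_group 4) G := qg_mk R.
Let gens : 4.-tuple (GO_plus n) :=
  [tuple Gx o0 o1; Gz (i0 hn) (i1 hn); Gs (sym_U hn); Gs (sym_V n)].

Lemma gens_sigma : fg_eval gens gen_sigma = Gx o0 o1. Proof. exact: fg_eval_gen. Qed.
Lemma gens_Z : fg_eval gens gen_Z = Gz (i0 hn) (i1 hn). Proof. exact: fg_eval_gen. Qed.
Lemma gens_U : fg_eval gens gen_U = Gs (sym_U hn). Proof. exact: fg_eval_gen. Qed.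
Lemma gens_V : fg_eval gens gen_V = Gs (sym_V n). Proof. exact: fg_eval_gen. Qed.

Lemma tuple2_map (A B : Type) (f : A -> B) a b :
  map_tuple f [tuple a; b] = [tuple f a; f b].
Proof. exact: val_inj. Qed.

(** Both sides equal the opposite root element: U = x y x by Gs_tperm, and
    y = x^U. *)
Lemma Gx_braid : Gs (sym_U hn) * Gx o0 o1 * Gs (sym_U hn) = Gx o0 o1 * Gs (sym_U hn) * Gx o0 o1.
Proof.
pose u := Gs (sym_U hn); pose x := Gx o0 o1; pose y := Gx o1 o0.
have uu : u * u = 1 by rewrite -gmulfM tperm2 gmulf1.
have xx : x * x = 1 by apply: GxK.
have xu : x ^ u = y by rewrite /x Gx_Gs // sU0 sU1.
have uE : u = x * y * x by apply: Gs_tperm.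
have -> : u * x * u = y.
  by rewrite -xu conjgE mulgA; congr (_ * _ * _); apply/eqP; rewrite -mulg_eq1 uu.
by rewrite -/u -/x {1}uE !mulgA xx mul1g -mulgA xx mulg1.
Qed.

(** For the relators of SL(2,2) it suffices that the two isometries are
    involutions with the braid relation: a word that is trivial in SL(2,2)
    reduces to the trivial normal form, and it reduces in the same way in
    every other such group. *)
Lemma gens_relators r : R r -> fg_eval gens r = 1.
Proof.
case=> [[/= rel|[r' RSr' <-]]|[r' RLr' <-]].
- apply: (@GO_relators n hn); have := map_f (fg_eval gens) rel.
  by rewrite relators_map [relators _ _ _ _ _]/= gens_sigma gens_Z gens_U gens_V.
- rewrite fg_eval_comp tuple2_map /= gens_U gens_V -(tuple2_map (@Gs n)).
  by rewrite -fg_eval_comp (presents_rel hRS RSr') gmulf1.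
rewrite fg_eval_comp tuple2_map /= gens_sigma gens_U.
have [aK bK ab] := SL2_braid; have [a1 b1 nab] := SL2_neq.
have E := presents_rel hRL RLr'; rewrite (fg_eval_braid aK bK ab) in E.
have uu : Gs (sym_U hn) * Gs (sym_U hn) = 1 by rewrite -gmulfM tperm2 gmulf1.
have xx : Gx o0 o1 * Gx o0 o1 = 1 by apply: GxK.
rewrite (fg_eval_braid xx uu Gx_braid).
by rewrite (braid_nf_eq1 aK bK a1 b1 nab (braid_code_lt _) E).
Qed.

Let sigma := mk gen_sigma.
Let Z := mk gen_Z.
Let U := mk gen_U.
Let V := mk gen_V.

Lemma mk_R r : R r -> mk r = 1.
Proof.
move=> Rr; rewrite -(gmulf1 (s := mk)); apply/qg_mkP.
by rewrite mulg1; apply: nclV; apply: sub_gen_smallest.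
Qed.

Lemma presented_sl2 r : fg_eval [tuple SL2_sigma; SL2_U] r = 1 ->
  fg_eval [tuple sigma; U] r = 1.
Proof.
apply: (presents_kernel hRL) => r' Rr'.
rewrite /sigma /U -(tuple2_map mk) -fg_eval_comp; apply: mk_R.
by right; exists r'.
Qed.

Lemma presented_isomorphism :
  exists phi : UMagmaMorphism.type G (GO_plus n), injective phi /\ range phi = @Omega_plus n.
Proof.
have [phi phiE] := quotient_hom gens_relators.
have [rho rhoE] : exists rho : UMagmaMorphism.type {perm 'I_n} G,
    forall a, rho (fg_eval [tuple sym_U hn; sym_V n] a) = fg_eval [tuple U; V] a.
  apply: factor_hom; first exact: sym_generated.
  apply: (presents_kernel hRS) => r Rr.
  rewrite /U /V -(tuple2_map mk) -fg_eval_comp; apply: mk_R.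
  by left; right; exists r.
have rhoU : rho (sym_U hn) = U.
  by have := rhoE (fg_gen ord0); rewrite !fg_eval_gen.
have rhoV : rho (sym_V n) = V.
  by have := rhoE (fg_gen ord_max); rewrite !fg_eval_gen.
have rels r : r \in relators n sigma Z (rho (sym_U hn)) (rho (sym_V n)) -> r = 1.
  rewrite rhoU rhoV -relators_map => /mapP[r' rel ->]; apply: mk_R.
  by left; left.
have phi_rho s : phi (rho s) = Gs s.
  have phiU : phi U = Gs (sym_U hn) by exact: etrans (phiE gen_U) gens_U.
  have phiV : phi V = Gs (sym_V n) by exact: etrans (phiE gen_V) gens_V.
  have [a <-] := sym_generated hn s.
  rewrite rhoE fg_eval_comp tuple2_map [phi U]phiU [phi V]phiV.
  by rewrite -(tuple2_map (@Gs n)) -fg_eval_comp.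
have phi_Z : phi Z = Gz (i0 hn) (i1 hn) by exact: etrans (phiE gen_Z) gens_Z.
have phi_sigma : phi sigma = Gx o0 o1 by exact: etrans (phiE gen_sigma) gens_sigma.
pose ga : free_group 2 := fg_gen ord0; pose gb : free_group 2 := fg_gen ord_max.
have [aK bK ab] := SL2_braid.
have sigmaK : sigma * sigma = 1.
  have := @presented_sl2 (ga * ga); rewrite !gmulfM /= !fg_eval_gen => H.
  exact: H aK.
have braid : rho (sym_U hn) * sigma * rho (sym_U hn) = sigma * rho (sym_U hn) * sigma.
  have := @presented_sl2 (gb * ga * gb * (ga * gb * ga)^-1).
  rewrite rhoU !(gmulfM, gmulfV) /= !fg_eval_gen [_ * _ * SL2_U]ab => H.
  by apply/divg1_eq/H; apply: mulgV.
have mkE a : mk a = fg_eval [tuple sigma; Z; U; V] a.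
  rewrite -{1}[a]fg_eval_gens fg_eval_comp; congr (fg_eval _ a).
  apply: eq_from_tnth => i; rewrite tnth_map tnth_mktuple (tnth_nth 1).
  by case: i => [[|[|[|[|//]]]] lt_i] /=; congr (mk (fg_gen _)); apply: val_inj.
have cW w := cell_W rels phi_rho phi_Z sigmaK braid (w := w).
have cs := cell_sigma rels phi_rho phi_Z sigmaK braid.
have Wr := W_rho hn rho Z.
have WZ := W_Z rels.
have WV w := W_V rels (w := w).
have cells g : cell hn rho phi sigma Z g.
  rewrite -[g]qg_mkK -[qg_mk _ _]/(mk _) mkE; move: (generic_quotient.repr g).
  have sV : sigma^-1 = sigma by apply/eqP; rewrite eq_sym -mulg_eq1 sigmaK.
  apply: word_ind => [|h i Ch|h i Ch]; first exact: cell1.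
    rewrite (tnth_nth 1); case: i => [[|[|[|[|//]]]] lt_i] /=.
    - exact: cs.
    - exact: cW WZ Ch.
    - by rewrite -rhoU; apply: cW (Wr _) Ch.
    - by rewrite -rhoV; apply: cW (Wr _) Ch.
  rewrite (tnth_nth 1); case: i => [[|[|[|[|//]]]] lt_i] /=.
  - by rewrite sV; apply: cs.
  - exact: cW (WV _ WZ) Ch.
  - by rewrite -rhoU; apply: cW (WV _ (Wr _)) Ch.
  - by rewrite -rhoV; apply: cW (WV _ (Wr _)) Ch.
exists phi; split.
  apply: gmulf_inj => g.
  exact: (kernel_trivial rels phi_rho phi_Z sigmaK phi_sigma (cells g)).
have even g : refl_prod false (phi g).
  rewrite -[g]qg_mkK phiE; move: (generic_quotient.repr g).
  have gens_even i : refl_prod false (tnth gens i).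
    rewrite (tnth_nth 1); case: i => [[|[|[|[|//]]]] lt_i] /=.
    - exact: refl_prod_Gx.
    - exact: refl_prod_Gz.
    - exact: refl_prod_Gs.
    - exact: refl_prod_Gs.
  apply: word_ind => [|h i Ch|h i Ch]; first exact: refl_prod1.
    exact: (@refl_prodM _ false false).
  by apply: (@refl_prodM _ false false) => //; apply: refl_prodV.
have n0 : (0 < n)%N by apply: ltnW (ltnW hn).
have img := @elimination_all n (fun g => exists h, phi h = g) _ _ _ _ n0.
apply/seteqP; split=> [y [g _ <-]|g /= g_even]; first exact: refl_prod_dickson (even g).
have [||||[h <-]|[h E]] := img _ _ _ _ g.
- by exists 1; rewrite gmulf1.
- by move=> x y [a <-] [b <-]; exists (a * b); rewrite gmulfM.
- by move=> x [a <-]; exists a^-1; rewrite gmulfV.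
- move=> a b nab; exists (xroot hn rho phi sigma Z a b).
  exact: (phi_x rels phi_rho phi_Z phi_sigma nab).
- by exists h.
have t_odd := refl_prod_Gt (t0_quad n0).
have := refl_prod_dickson (refl_prodM t_odd (even h)).
by rewrite E mulgA GtK ?t0_quad // mul1g g_even.
Qed.
End Assembly.

Local Close Scope group_scope.
Local Close Scope ring_scope.

Theorem theorem9p10 (n : nat) (hn : 2 < n) (RS RL : set (free_group 2))
    (hRS : presents [tuple sym_U hn; sym_V n] RS)
    (hRL : presents [tuple SL2_sigma; SL2_U] RL) :
  exists phi : {multiplicative presented_group (Omega_relators n RS RL) -> GO_plus n},
    injective phi /\ range phi = @Omega_plus n.
Proof.
by have [phi [phi_inj phi_img]] := presented_isomorphism hRS hRL; exists phi.
Qed.
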